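(* Let $a\in\mathbf{C}$, let $f_1$ be a complex function holomorphic at the point $a$, and let $f_2$ be a meromorphic function with a pole of order $m$ at the same point $a$. Then $$\operatorname*{p.p.}_{z=a}\bigl(f_1(z)\cdot f_2(z)\bigr)=\sum_{k=0}^{m}\frac{f_1^{(k)}(a)}{k!}\,\operatorname*{p.p.}_{z=a}\bigl((z-a)^k\cdot f_2(z)\bigr).$$
   Context: For a function $f$ meromorphic at $a\in\mathbf{C}$, the principal part of $f$ at the point $a$ is the complex number $$\operatorname*{p.p.}_{z=a} f(z)=\lim_{\rho\to 0_+}\frac{1}{2\pi i}\oint_{|z-a|=\rho}\frac{f(z)}{z-a}\,dz .$$ (This is a number, not the polar part of the Laurent series.) ''Holomorphic at the point $a$'' means complex differentiable everywhere within some open disk centered at $a$. *)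

(* Defs.v *)
From Stdlib Require Import Reals.
From Coquelicot Require Export Coquelicot.

Local Open Scope C_scope.

(** Functions are total on [C]; only their values near the point matter. *)
Definition holomorphic_at (f : C -> C) (a : C) : Prop :=
  exists r : R, (0 < r)%R /\
    forall z : C, (Cmod (z - a) < r)%R ->
      ex_derive (K := C_AbsRing) (V := C_NormedModule) f z.

(** The value of [f] at [a] itself is irrelevant, and the factor [g] is only
    required to represent [f] on a punctured disk.  A pole has order at least
    one. *)
Definition pole_of_order (f : C -> C) (a : C) (m : nat) : Prop :=
  (0 < m)%nat /\
  exists g : C -> C,
    holomorphic_at g a /\ g a <> 0 /\
    exists r : R, (0 < r)%R /\
      forall z : C, z <> a -> (Cmod (z - a) < r)%R -> f z = g z / (z - a) ^ m.

(** Iterated complex derivative, the analogue of [Derive_n].  [C_derive] is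
    total; by [is_C_derive_unique] it is the derivative where there is one. *)
Fixpoint C_derive_n (f : C -> C) (n : nat) (z : C) : C :=
  match n with
  | O => f z
  | S n => C_derive (C_derive_n f n) z
  end.

Definition cis (t : R) : C := (cos t, sin t).

(** Pullback of [f z dz] along [t |-> a + rho e^(it)]. *)
Definition circle_integrand (f : C -> C) (a : C) (rho t : R) : C :=
  f (a + RtoC rho * cis t) * (Ci * RtoC rho * cis t).

Definition ex_circle_int (f : C -> C) (a : C) (rho : R) : Prop :=
  ex_RInt (V := C_R_NormedModule) (circle_integrand f a rho) 0 (2 * PI).

(** Counterclockwise integral of [f] over the circle [|z - a| = rho]. *)
Definition circle_int (f : C -> C) (a : C) (rho : R) : C :=
  RInt (V := C_R_CompleteNormedModule) (circle_integrand f a rho) 0 (2 * PI).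

Definition circle_mean (f : C -> C) (a : C) (rho : R) : C :=
  1 / (RtoC (2 * PI) * Ci) * circle_int (fun z => f z / (z - a)) a rho.

(** Since [RInt] is total, the existence of the integrals on all sufficiently
    small circles is required explicitly. *)
Definition is_pp (f : C -> C) (a l : C) : Prop :=
  at_right 0 (fun rho => ex_circle_int (fun z => f z / (z - a)) a rho) /\
  filterlim (circle_mean f a) (at_right 0)
    (locally (T := C_R_CompleteNormedModule) l).

Definition ex_pp (f : C -> C) (a : C) : Prop := exists l : C, is_pp f a l.

(** Total, like [RInt]: meaningful when [ex_pp f a] holds. *)
Definition pp (f : C -> C) (a : C) : C :=
  iota (T := C_R_CompleteNormedModule) (is_pp f a).

Lemma is_pp_unique (f : C -> C) (a l : C) : is_pp f a l -> pp f a = l.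
Proof.
intros H.
apply (iota_unique (V := C_R_CompleteNormedModule)); [|exact H].
intros y [_ Hy]; destruct H as [_ Hl].
exact (filterlim_locally_unique (V := C_R_NormedModule) _ _ _ Hy Hl).
Qed.

Lemma pp_correct (f : C -> C) (a : C) : ex_pp f a -> is_pp f a (pp f a).
Proof.
intros [l H]; rewrite (is_pp_unique f a l H); exact H.
Qed.

(* Main.v *)
Require Import Defs.
From Stdlib Require Import Arith Reals Lra Lia.
From Coquelicot Require Import Coquelicot.

(** Since [dz / (z - a) = i dt] on the circle [z = a + rho e^(it)], the
    principal part of [f] at [a] is the limit of the averages of [f] over small
    circles centred at [a].  Such averages are linear in [f], the nonzero powers
    of [z - a] have average [0], and a function that is [O(z - a)] contributes
    nothing in the limit.

    Write [f2 z = g z / (z - a)^m] near [a] and expand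
    [f1 = T + O((z - a)^(m+1))] with [T] the Taylor polynomial of [f1] of degree
    [m].  Then [(f1 - T) f2 = O(z - a)] has principal part [0], so [f1 f2] and
    [T f2] have the same principal part, which by linearity is the sum to be
    found.  Each summand has a principal part because
    [(z - a)^k f2 = g / (z - a)^(m-k)], and expanding [g] in the same way shows
    that the principal part of [g / (z - a)^p] is the Taylor coefficient of [g]
    of index [p] ([average_tends_taylor_coef]).

    The substance is Taylor's formula ([taylor_remainder]) for functions that are
    only known to be complex differentiable at each point of a disk.  It
    follows by induction, integrating the formula for [f'] along segments, as
    soon as the derivative of a holomorphic function is known to be holomorphic
    ([holomorphic_at_C_derive]).  For this:

    - integrals of a holomorphic [f] over triangles vanish, by repeated
      bisection ([goursat]), so [f] has a primitive [F] on a disk, and [F] has a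
      primitive [Phi] ([holomorphic_primitive]);
    - [f] is bounded near [a], so [F] is Lipschitz and [Phi] has a second order
      Taylor estimate that is uniform on the disk; this is exactly what is
      needed to differentiate under the integral sign in the homotopy that
      shrinks a circle to a point, and yields Cauchy's formula for [Phi]
      ([cauchy_formula]) before anything is known about [f'];
    - Cauchy's formula exhibits [Phi] as an integral of [1 / (z - w)], which can
      be differentiated in [w] as often as desired
      ([is_Cderive_cauchy_transform]); the third derivative of [Phi] is [f'],
      so [f'] is differentiable. *)

Local Open Scope R_scope.

(** * Complex derivatives, and paths in the plane *)

(* [C] is a normed module over [C] and over [R].  [Cderive] is differentiation in
   a complex variable; [Pderive] and [Pcont] concern paths, that is functions of a
   real variable with values in [C], and [CInt] is the integral of such a path. *)
Local Notation is_Cderive := (is_derive (K := C_AbsRing) (V := C_NormedModule)).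
Local Notation ex_Cderive := (ex_derive (K := C_AbsRing) (V := C_NormedModule)).
Local Notation is_Pderive := (is_derive (K := R_AbsRing) (V := C_R_NormedModule)).
Local Notation Pcont := (continuous (T := R_UniformSpace) (U := C_R_NormedModule)).
Local Notation is_CInt := (is_RInt (V := C_R_NormedModule)).
Local Notation ex_CInt := (ex_RInt (V := C_R_NormedModule)).

Lemma is_Cderive_eps (f : C -> C) (z l : C) :
  is_Cderive f z l <->
  forall eps, 0 < eps -> exists d, 0 < d /\ forall w, Cmod (w - z) < d ->
    Cmod (f w - f z - l * (w - z)) <= eps * Cmod (w - z).
Proof.
split.
- intros [_ H] eps Heps.
  specialize (H z (fun P HP => HP) (mkposreal eps Heps)).
  destruct H as [d Hd]; exists d; split; [apply cond_pos|].
  intros w Hw; specialize (Hd w Hw).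
  replace (l * (w - z))%C with ((w - z) * l)%C by ring; exact Hd.
- intros H; split; [apply is_linear_scal_l|].
  intros x Hx.
  rewrite <- (is_filter_lim_locally_unique _ _ Hx).
  intros [eps Heps]; destruct (H eps Heps) as [d [Hd Hf]].
  exists (mkposreal d Hd); intros w Hw; specialize (Hf w Hw).
  replace (l * (w - z))%C with ((w - z) * l)%C in Hf by ring; exact Hf.
Qed.

Lemma is_Pderive_eps (f : R -> C) (t : R) (l : C) :
  is_Pderive f t l <->
  forall eps, 0 < eps -> exists d, 0 < d /\ forall u, Rabs (u - t) < d ->
    Cmod (f u - f t - l * RtoC (u - t)) <= eps * Rabs (u - t).
Proof.
assert (E : forall u, minus (minus (f u) (f t)) (scal (V := C_R_NormedModule) (minus u t) l)
   = (f u - f t - l * RtoC (u - t))%C).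
{ intros u. destruct l as [lx ly]. apply injective_projections; simpl;
  unfold minus, plus, opp, scal; simpl; unfold mult; simpl;
  unfold prod_plus, prod_scal, scal; simpl; unfold mult; simpl; ring. }
split.
- intros [_ H] eps Heps.
  specialize (H t (fun P HP => HP) (mkposreal eps Heps)).
  destruct H as [d Hd]; exists d; split; [apply cond_pos|].
  intros w Hw; specialize (Hd w Hw). rewrite <- E, Cmod_norm; exact Hd.
- intros H; split; [apply is_linear_scal_l|].
  intros x Hx.
  rewrite <- (is_filter_lim_locally_unique _ _ Hx).
  intros [eps Heps]; destruct (H eps Heps) as [d [Hd Hf]].
  exists (mkposreal d Hd); intros w Hw; specialize (Hf w Hw).
  rewrite <- E, Cmod_norm in Hf; exact Hf.
Qed.

(** The uniform structure of [C] is that of [R * R], with the maximum distance,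
    hence the factor [sqrt 2]. *)
Lemma Pcont_eps (f : R -> C) (t : R) :
  Pcont f t <->
  forall eps, 0 < eps -> exists d, 0 < d /\ forall u, Rabs (u - t) < d ->
    Cmod (f u - f t) < eps.
Proof.
split.
- intros H eps Heps.
  assert (H2 : 0 < eps / sqrt 2).
  { apply Rdiv_lt_0_compat; [lra|apply sqrt_lt_R0; lra]. }
  destruct (H (fun w => ball (M := C_R_NormedModule) (f t) (eps / sqrt 2) w)) as [d Hd].
  { exists (mkposreal _ H2); intros y Hy; exact Hy. }
  exists d; split; [apply cond_pos|]. intros u Hu; specialize (Hd u Hu).
  assert (K := C_NormedModule_mixin_compat2 _ _ (mkposreal _ H2) Hd).
  simpl in K. replace (sqrt 2 * (eps / sqrt 2)) with eps in K; [exact K|].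
  field. apply Rgt_not_eq, sqrt_lt_R0; lra.
- intros H P [eps HP].
  destruct (H eps (cond_pos eps)) as [d [Hd Hf]].
  exists (mkposreal d Hd); intros u Hu; apply HP.
  apply C_NormedModule_mixin_compat1. exact (Hf u Hu).
Qed.

Lemma Cmod_sub_sym (x y : C) : Cmod (x - y) = Cmod (y - x).
Proof. rewrite <- Cmod_opp; f_equal; ring. Qed.

Lemma Cmod_sub_triangle (x y z : C) : Cmod (x - z) <= Cmod (x - y) + Cmod (y - z).
Proof. replace (x - z)%C with ((x - y) + (y - z))%C by ring; apply Cmod_triangle. Qed.

Lemma Cmod_sub_le (x y : C) : Cmod (x - y) <= Cmod x + Cmod y.
Proof. unfold Cminus; eapply Rle_trans; [apply Cmod_triangle|]; rewrite Cmod_opp; lra. Qed.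

Lemma Cmod_triangle_rev (x y : C) : Cmod x - Cmod y <= Cmod (x - y).
Proof.
assert (H := Cmod_triangle (x - y) y); replace (x - y + y)%C with x in H by ring; lra.
Qed.

Lemma Cmod_center (a : C) (r : R) : 0 < r -> Cmod (a - a) < r.
Proof. intros H; replace (a - a)%C with (RtoC 0) by ring; rewrite Cmod_0; exact H. Qed.

Lemma is_Cderive_lipschitz (f : C -> C) (z l : C) : is_Cderive f z l ->
  exists d, 0 < d /\ forall w, Cmod (w - z) < d ->
    Cmod (f w - f z) <= (Cmod l + 1) * Cmod (w - z).
Proof.
intros H; destruct (proj1 (is_Cderive_eps _ _ _) H 1 Rlt_0_1) as [d [Hd Hf]].
exists d; split; [exact Hd|]; intros w Hw; specialize (Hf w Hw).
replace (f w - f z)%C with ((f w - f z - l * (w - z)) + l * (w - z))%C by ring.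
eapply Rle_trans; [apply Cmod_triangle|]; rewrite Cmod_mult; lra.
Qed.

Lemma Pcont_comp (f : C -> C) (g : R -> C) (t : R) :
  ex_Cderive f (g t) -> Pcont g t -> Pcont (fun u => f (g u)) t.
Proof.
intros [l Hl] Hg.
destruct (is_Cderive_lipschitz _ _ _ Hl) as [d [Hd Hf]].
apply Pcont_eps; intros eps Heps.
assert (Hl1 : 0 < Cmod l + 1) by (assert (H := Cmod_ge_0 l); lra).
assert (He : 0 < Rmin d (eps / (Cmod l + 1))).
{ apply Rmin_pos; [exact Hd|apply Rdiv_lt_0_compat; lra]. }
destruct (proj1 (Pcont_eps g t) Hg _ He) as [d' [Hd' Hg']].
exists d'; split; [exact Hd'|]; intros u Hu; specialize (Hg' u Hu).
assert (K1 := Rmin_l d (eps / (Cmod l + 1))). assert (K2 := Rmin_r d (eps / (Cmod l + 1))).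
eapply Rle_lt_trans; [apply Hf; lra|].
replace eps with ((Cmod l + 1) * (eps / (Cmod l + 1))) by (field; lra).
apply Rmult_lt_compat_l; lra.
Qed.

Lemma is_Pderive_comp (f : C -> C) (g : R -> C) (t : R) (l m : C) :
  is_Cderive f (g t) l -> is_Pderive g t m ->
  is_Pderive (fun u => f (g u)) t (l * m)%C.
Proof.
intros Hf Hg.
destruct (is_Cderive_lipschitz _ _ _ Hf) as [d0 [Hd0 Hlip]].
assert (Hf' := proj1 (is_Cderive_eps _ _ _) Hf).
assert (Hg' := proj1 (is_Pderive_eps _ _ _) Hg).
apply is_Pderive_eps; intros eps Heps.
assert (Pl : 0 <= Cmod l) by apply Cmod_ge_0.
assert (Pm : 0 <= Cmod m) by apply Cmod_ge_0.
set (e1 := eps / 2 / (Cmod m + 1)).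
assert (He1 : 0 < e1) by (unfold e1; repeat apply Rdiv_lt_0_compat; lra).
set (e2 := Rmin 1 (eps / 2 / (Cmod l + 1))).
assert (He2 : 0 < e2).
{ apply Rmin_pos; [lra|]; repeat apply Rdiv_lt_0_compat; lra. }
destruct (Hf' e1 He1) as [d1 [Hd1 H1]].
destruct (Hg' e2 He2) as [d2 [Hd2 H2]].
exists (Rmin d2 (d1 / (Cmod m + 1))); split.
{ apply Rmin_pos; [exact Hd2|apply Rdiv_lt_0_compat; lra]. }
intros u Hu.
assert (Hu2 : Rabs (u - t) < d2) by (eapply Rlt_le_trans; [exact Hu|apply Rmin_l]).
assert (Hu1 : Rabs (u - t) < d1 / (Cmod m + 1)) by (eapply Rlt_le_trans; [exact Hu|apply Rmin_r]).
specialize (H2 u Hu2).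
assert (Pa := Rabs_pos (u - t)).
assert (L1 : e2 <= 1) by apply Rmin_l.
assert (L2 : (Cmod l + 1) * e2 <= eps / 2).
{ replace (eps / 2) with ((Cmod l + 1) * (eps / 2 / (Cmod l + 1))) by (field; lra).
  apply Rmult_le_compat_l; [lra|apply Rmin_r]. }
assert (B : Cmod (g u - g t) <= (Cmod m + 1) * Rabs (u - t)).
{ replace (g u - g t)%C with ((g u - g t - m * RtoC (u - t)) + m * RtoC (u - t))%C by ring.
  eapply Rle_trans; [apply Cmod_triangle|]; rewrite Cmod_mult, Cmod_R.
  nra. }
assert (B1 : Cmod (g u - g t) < d1).
{ eapply Rle_lt_trans; [exact B|].
  replace d1 with ((Cmod m + 1) * (d1 / (Cmod m + 1))) by (field; lra).
  apply Rmult_lt_compat_l; lra. }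
specialize (H1 _ B1).
replace (f (g u) - f (g t) - l * m * RtoC (u - t))%C with
  ((f (g u) - f (g t) - l * (g u - g t)) + l * (g u - g t - m * RtoC (u - t)))%C by ring.
eapply Rle_trans; [apply Cmod_triangle|]; rewrite Cmod_mult.
assert (L3 : e1 * (Cmod m + 1) = eps / 2) by (unfold e1; field; lra).
assert (e1 * Cmod (g u - g t) <= e1 * ((Cmod m + 1) * Rabs (u - t)))
  by (apply Rmult_le_compat_l; lra).
assert (Cmod l * Cmod (g u - g t - m * RtoC (u - t)) <= Cmod l * (e2 * Rabs (u - t)))
  by (apply Rmult_le_compat_l; lra).
assert (Cmod l * (e2 * Rabs (u - t)) <= eps / 2 * Rabs (u - t)).
{ rewrite <- Rmult_assoc; apply Rmult_le_compat_r; [lra|nra]. }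
rewrite <- Rmult_assoc, L3 in H. lra.
Qed.

(** The two uniform structures of [C], given by [Cmod] and by the maximum
    distance, have the same neighbourhoods; continuity of products comes from the
    first one, the structure of a normed ring. *)
Lemma Pcont_AbsRing (f : R -> C) (t : R) :
  Pcont f t <-> continuous (T := R_UniformSpace) (U := AbsRing_UniformSpace C_AbsRing) f t.
Proof.
split; intros H P HP; apply H; apply locally_C; exact HP.
Qed.

Lemma Pcont_const (c : C) (t : R) : Pcont (fun _ => c) t.
Proof. apply continuous_const. Qed.

Lemma Pcont_plus (f g : R -> C) (t : R) :
  Pcont f t -> Pcont g t -> Pcont (fun u => f u + g u)%C t.
Proof. exact (continuous_plus (V := C_R_NormedModule) f g t). Qed.

Lemma Pcont_minus (f g : R -> C) (t : R) :
  Pcont f t -> Pcont g t -> Pcont (fun u => f u - g u)%C t.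
Proof. exact (continuous_minus (V := C_R_NormedModule) f g t). Qed.

Lemma Pcont_mult (f g : R -> C) (t : R) :
  Pcont f t -> Pcont g t -> Pcont (fun u => f u * g u)%C t.
Proof.
intros Hf Hg; apply Pcont_AbsRing.
apply (continuous_mult (K := C_AbsRing) f g t); apply Pcont_AbsRing; assumption.
Qed.

(** Complex derivatives below mostly arise this way: first order expansions are
    obtained algebraically, with an explicit quadratic remainder. *)
Lemma is_Cderive_quadratic (f : C -> C) (z l : C) (d K : R) : 0 < d ->
  (forall w, Cmod (w - z) < d ->
    Cmod (f w - f z - l * (w - z)) <= K * Cmod (w - z) ^ 2) ->
  is_Cderive f z l.
Proof.
intros Hd H; apply is_Cderive_eps; intros eps Heps.
assert (P : 0 < Rabs K + 1) by (assert (P := Rabs_pos K); lra).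
exists (Rmin d (eps / (Rabs K + 1))); split.
{ apply Rmin_pos; [exact Hd|apply Rdiv_lt_0_compat; lra]. }
intros w Hw; eapply Rle_trans.
{ apply H; eapply Rlt_le_trans; [exact Hw|apply Rmin_l]. }
assert (Hw2 : Cmod (w - z) < eps / (Rabs K + 1))
  by (eapply Rlt_le_trans; [exact Hw|apply Rmin_r]).
assert (P0 := Cmod_ge_0 (w - z)). assert (PK := Rle_abs K).
assert ((Rabs K + 1) * Cmod (w - z) <= eps).
{ replace eps with ((Rabs K + 1) * (eps / (Rabs K + 1))) by (field; lra).
  apply Rmult_le_compat_l; lra. }
simpl; rewrite Rmult_1_r, <- Rmult_assoc; apply Rmult_le_compat_r; nra.
Qed.

Lemma is_Pderive_continuous (f : R -> C) (t : R) (l : C) : is_Pderive f t l -> Pcont f t.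
Proof. intros H; apply ex_derive_continuous; exists l; exact H. Qed.

Lemma is_Pderive_pair (x y : R -> R) (t dx dy : R) :
  is_derive x t dx -> is_derive y t dy ->
  is_Pderive (fun u => (x u, y u)) t (dx, dy).
Proof.
intros Hx Hy.
apply (is_derive_ext (V := C_R_NormedModule) (fun u => plus (G := C_R_NormedModule)
  (scal (V := C_R_NormedModule) (x u) (1, 0)) (scal (V := C_R_NormedModule) (y u) (0, 1)))).
- intros u; apply injective_projections; simpl; unfold mult; simpl;
  unfold scal; simpl; unfold mult; simpl; unfold plus; simpl; ring.
- evar_last.
  + apply (is_derive_plus (V := C_R_NormedModule)); apply (is_derive_scal_l (V := C_R_NormedModule)); [exact Hx|exact Hy].
  + apply injective_projections; simpl; unfold scal; simpl; unfold mult; simpl; unfold plus; simpl; ring.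
Qed.

Lemma is_Pderive_line (p q : C) (t : R) :
  is_Pderive (fun u => p + RtoC u * q)%C t q.
Proof.
apply is_Pderive_eps; intros eps Heps; exists 1; split; [lra|]; intros u _.
assert (E : (p + RtoC u * q - (p + RtoC t * q) - q * RtoC (u - t))%C = 0%C)
  by (rewrite RtoC_minus; ring).
rewrite E, Cmod_0; apply Rmult_le_pos; [lra|apply Rabs_pos].
Qed.

Lemma Cmod_cis (t : R) : Cmod (cis t) = 1.
Proof.
unfold Cmod, cis; simpl fst; simpl snd.
replace (cos t ^ 2 + sin t ^ 2) with 1; [apply sqrt_1|].
assert (H := sin2_cos2 t); unfold Rsqr in H; simpl; lra.
Qed.

Lemma is_Pderive_cis (t : R) : is_Pderive cis t (Ci * cis t)%C.
Proof.
replace (Ci * cis t)%C with (- sin t, cos t).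
- apply is_Pderive_pair; auto_derive; auto; ring.
- apply injective_projections; simpl; ring.
Qed.

Lemma Pcont_cis (t : R) : Pcont cis t.
Proof. eapply is_Pderive_continuous, is_Pderive_cis. Qed.

(** * Integrals of complex-valued functions of a real variable *)

Lemma ex_CInt_cont (f : R -> C) (a b : R) : a <= b ->
  (forall t, a <= t <= b -> Pcont f t) -> ex_CInt f a b.
Proof.
intros Hab H; apply (ex_RInt_continuous (V := C_R_CompleteNormedModule)).
rewrite Rmin_left, Rmax_right by exact Hab; exact H.
Qed.

Lemma is_CInt_FTC (f df : R -> C) (a b : R) : a <= b ->
  (forall t, a <= t <= b -> is_Pderive f t (df t)) ->
  (forall t, a <= t <= b -> Pcont df t) ->
  is_CInt df a b (f b - f a)%C.
Proof.
intros Hab H1 H2; apply (is_RInt_derive (V := C_R_CompleteNormedModule) f df);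
rewrite Rmin_left, Rmax_right by exact Hab; assumption.
Qed.

Lemma is_CInt_unique (f : R -> C) (a b : R) (l1 l2 : C) :
  is_CInt f a b l1 -> is_CInt f a b l2 -> l1 = l2.
Proof.
intros H1 H2.
apply (is_RInt_unique (V := C_R_CompleteNormedModule)) in H1, H2; congruence.
Qed.

Lemma is_CInt_ext (f g : R -> C) (a b : R) (l : C) : a <= b ->
  (forall t, a < t < b -> f t = g t) -> is_CInt f a b l -> is_CInt g a b l.
Proof.
intros Hab H; apply is_RInt_ext; rewrite Rmin_left, Rmax_right by exact Hab; exact H.
Qed.

(** The integral is that of an [R]-module, so complex constants are pulled out by
    coordinates. *)
Lemma is_CInt_mult (c : C) (f : R -> C) (a b : R) (l : C) :
  is_CInt f a b l -> is_CInt (fun t => c * f t)%C a b (c * l)%C.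
Proof.
intros H.
assert (H1 := is_RInt_fct_extend_fst (U := R_NormedModule) (V := R_NormedModule) f a b l H).
assert (H2 := is_RInt_fct_extend_snd (U := R_NormedModule) (V := R_NormedModule) f a b l H).
apply (is_RInt_fct_extend_pair (U := R_NormedModule) (V := R_NormedModule)); simpl.
- apply (is_RInt_minus (V := R_NormedModule));
    apply (is_RInt_scal (V := R_NormedModule)); assumption.
- apply (is_RInt_plus (V := R_NormedModule));
    apply (is_RInt_scal (V := R_NormedModule)); assumption.
Qed.

Lemma is_CInt_plus (f g : R -> C) (a b : R) (lf lg : C) :
  is_CInt f a b lf -> is_CInt g a b lg ->
  is_CInt (fun t => f t + g t)%C a b (lf + lg)%C.
Proof. exact (is_RInt_plus (V := C_R_NormedModule) f g a b lf lg). Qed.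

Lemma is_CInt_minus (f g : R -> C) (a b : R) (lf lg : C) :
  is_CInt f a b lf -> is_CInt g a b lg ->
  is_CInt (fun t => f t - g t)%C a b (lf - lg)%C.
Proof. exact (is_RInt_minus (V := C_R_NormedModule) f g a b lf lg). Qed.

Lemma is_CInt_bound (f : R -> C) (a b M : R) (l : C) : a <= b ->
  (forall t, a <= t <= b -> Cmod (f t) <= M) ->
  is_CInt f a b l -> Cmod l <= (b - a) * M.
Proof.
intros Hab H Hl.
rewrite Cmod_norm. apply (norm_RInt_le_const (V := C_R_NormedModule) f a b l M Hab); [|exact Hl].
intros t Ht; specialize (H t Ht); rewrite Cmod_norm in H; exact H.
Qed.

Definition CInt (f : R -> C) (a b : R) : C := RInt (V := C_R_CompleteNormedModule) f a b.

Lemma CInt_correct (f : R -> C) (a b : R) : ex_CInt f a b -> is_CInt f a b (CInt f a b).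
Proof. apply (RInt_correct (V := C_R_CompleteNormedModule)). Qed.

Lemma CInt_unique (f : R -> C) (a b : R) (l : C) : is_CInt f a b l -> CInt f a b = l.
Proof. apply (is_RInt_unique (V := C_R_CompleteNormedModule)). Qed.

(** * Integrals along segments *)

Definition seg_point (p q : C) (t : R) : C := (p + RtoC t * (q - p))%C.

Definition seg_cont (f : C -> C) (p q : C) : Prop :=
  forall t, 0 <= t <= 1 -> Pcont (fun u => f (seg_point p q u)) t.

Definition seg_int (f : C -> C) (p q : C) : C :=
  ((q - p) * CInt (fun t => f (seg_point p q t)) 0 1)%C.

Definition tri_int (f : C -> C) (p q s : C) : C :=
  (seg_int f p q + seg_int f q s + seg_int f s p)%C.

Lemma is_Pderive_seg_point (p q : C) (t : R) : is_Pderive (seg_point p q) t (q - p)%C.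
Proof. apply is_Pderive_line. Qed.

Lemma Pcont_seg_point (p q : C) (t : R) : Pcont (seg_point p q) t.
Proof. eapply is_Pderive_continuous, is_Pderive_seg_point. Qed.

Lemma is_CInt_seg (f : C -> C) (p q : C) : seg_cont f p q ->
  is_CInt (fun t => (q - p) * f (seg_point p q t))%C 0 1 (seg_int f p q).
Proof.
intros H; apply is_CInt_mult, CInt_correct, ex_CInt_cont; [lra|exact H].
Qed.

Lemma seg_int_FTC (F f : C -> C) (p q : C) : seg_cont f p q ->
  (forall t, 0 <= t <= 1 -> is_Cderive F (seg_point p q t) (f (seg_point p q t))) ->
  seg_int f p q = (F q - F p)%C.
Proof.
intros Hc HF.
apply (is_CInt_unique (fun t => (q - p) * f (seg_point p q t))%C 0 1); [apply is_CInt_seg, Hc|].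
replace (F q - F p)%C with (F (seg_point p q 1) - F (seg_point p q 0))%C.
2:{ unfold seg_point; f_equal; [|f_equal]; f_equal; ring. }
apply (is_CInt_FTC (fun t => F (seg_point p q t))); [lra| |].
- intros t Ht; rewrite Cmult_comm. apply is_Pderive_comp; [apply HF, Ht|].
  apply is_Pderive_seg_point.
- intros t Ht; apply Pcont_mult; [apply Pcont_const|apply Hc, Ht].
Qed.

Lemma seg_int_close (f g : C -> C) (p q : C) (M : R) :
  seg_cont f p q -> seg_cont g p q ->
  (forall t, 0 <= t <= 1 -> Cmod (f (seg_point p q t) - g (seg_point p q t)) <= M) ->
  Cmod (seg_int f p q - seg_int g p q) <= M * Cmod (q - p).
Proof.
intros Hf Hg H.
replace (M * Cmod (q - p)) with ((1 - 0) * (M * Cmod (q - p))) by ring.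
eapply is_CInt_bound; [lra| |apply is_CInt_minus; apply is_CInt_seg; eassumption].
intros t Ht; simpl.
replace ((q - p) * f (seg_point p q t) - (q - p) * g (seg_point p q t))%C
  with ((f (seg_point p q t) - g (seg_point p q t)) * (q - p))%C by ring.
rewrite Cmod_mult; apply Rmult_le_compat_r; [apply Cmod_ge_0|apply H, Ht].
Qed.

Lemma seg_cont_const (c p q : C) : seg_cont (fun _ => c) p q.
Proof. intros t _; apply Pcont_const. Qed.

Lemma seg_int_const (c p q : C) : seg_int (fun _ => c) p q = (c * (q - p))%C.
Proof.
unfold seg_int; rewrite Cmult_comm; f_equal.
apply CInt_unique. evar_last.
- apply (is_RInt_const (V := C_R_NormedModule)).
- apply injective_projections; simpl; unfold scal; simpl; unfold mult; simpl; ring.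
Qed.

Lemma seg_point_ball (a p q : C) (r t : R) : 0 <= t <= 1 ->
  Cmod (p - a) <= r -> Cmod (q - a) <= r -> Cmod (seg_point p q t - a) <= r.
Proof.
intros Ht Hp Hq.
replace (seg_point p q t - a)%C with (RtoC (1 - t) * (p - a) + RtoC t * (q - a))%C.
2:{ unfold seg_point; rewrite RtoC_minus; ring. }
eapply Rle_trans; [apply Cmod_triangle|].
rewrite !Cmod_mult, !Cmod_R, !Rabs_right by lra. nra.
Qed.

Lemma seg_point_dist (p q : C) (t : R) : 0 <= t <= 1 ->
  Cmod (seg_point p q t - p) <= Cmod (q - p).
Proof.
intros Ht; assert (P := Cmod_ge_0 (q - p)).
replace (seg_point p q t - p)%C with (RtoC t * (q - p))%C by (unfold seg_point; ring).
rewrite Cmod_mult, Cmod_R, Rabs_right by lra; nra.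
Qed.

Lemma seg_point_disk (a p q : C) (r t : R) : 0 <= t <= 1 ->
  Cmod (p - a) < r -> Cmod (q - a) < r -> Cmod (seg_point p q t - a) < r.
Proof.
intros Ht Hp Hq.
apply Rle_lt_trans with (Rmax (Cmod (p - a)) (Cmod (q - a))).
- apply seg_point_ball; [exact Ht|apply Rmax_l|apply Rmax_r].
- apply Rmax_lub_lt; assumption.
Qed.

Lemma seg_point_0 (p q : C) : seg_point p q 0 = p.
Proof. unfold seg_point; ring. Qed.

Lemma seg_point_1 (p q : C) : seg_point p q 1 = q.
Proof. unfold seg_point; ring. Qed.

(** Sub-segments are handled through one affine change of variable; reversing a
    segment ([al = 1], [be = 0]) and halving it are special cases. *)
Lemma is_CInt_subsegment (f : C -> C) (p q : C) (al be : R) : seg_cont f p q ->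
  0 <= al <= 1 -> 0 <= be <= 1 ->
  is_CInt (fun t => (q - p) * f (seg_point p q t))%C al be
    (seg_int f (seg_point p q al) (seg_point p q be)).
Proof.
intros H Ha Hb.
set (p' := seg_point p q al); set (q' := seg_point p q be).
assert (E : forall t, seg_point p' q' t = seg_point p q ((be - al) * t + al)).
{ intros t; unfold p', q', seg_point; rewrite RtoC_plus, RtoC_mult, RtoC_minus; ring. }
assert (Hin : forall t, 0 <= t <= 1 -> 0 <= (be - al) * t + al <= 1) by (intros; nra).
assert (H' : seg_cont f p' q').
{ intros t Ht.
  apply (continuous_ext (fun u => f (seg_point p q ((be - al) * u + al)))).
  { intros u; f_equal; symmetry; apply E. }
  apply (continuous_comp (fun u => (be - al) * u + al) (fun u => f (seg_point p q u))).
  - apply (ex_derive_continuous (V := R_NormedModule)); auto_derive; exact I.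
  - apply H, Hin, Ht. }
assert (HI : is_CInt (fun t => (q - p) * f (seg_point p q t))%C al be
    (CInt (fun t => (q - p) * f (seg_point p q t))%C al be)).
{ apply CInt_correct, (ex_RInt_continuous (V := C_R_CompleteNormedModule)).
  intros t Ht; apply Pcont_mult; [apply Pcont_const|apply H].
  split; [apply Rle_trans with (2 := proj1 Ht); apply Rmin_glb; lra
         |apply Rle_trans with (1 := proj2 Ht); apply Rmax_lub; lra]. }
replace (seg_int f p' q') with (CInt (fun t => (q - p) * f (seg_point p q t))%C al be);
  [exact HI|].
apply (is_CInt_unique (fun t => (q' - p') * f (seg_point p' q' t))%C 0 1); [|apply is_CInt_seg, H'].
eapply is_CInt_ext; [lra| |apply (is_RInt_comp_lin (V := C_R_NormedModule)
   (fun t => (q - p) * f (seg_point p q t))%C (be - al) al 0 1)].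
- intros t _. cbv beta. rewrite E.
  replace (q' - p')%C with (RtoC (be - al) * (q - p))%C
    by (unfold p', q', seg_point; rewrite RtoC_minus; ring).
  rewrite <- Cmult_assoc.
  apply injective_projections; simpl; unfold scal; simpl; unfold mult; simpl; ring.
- replace ((be - al) * 0 + al) with al by ring.
  replace ((be - al) * 1 + al) with be by ring. exact HI.
Qed.

Lemma seg_int_swap (f : C -> C) (p q : C) : seg_cont f p q ->
  seg_int f q p = (- seg_int f p q)%C.
Proof.
intros H.
apply (is_CInt_unique (fun t => (q - p) * f (seg_point p q t))%C 1 0).
- assert (K := is_CInt_subsegment f p q 1 0 H ltac:(lra) ltac:(lra)).
  rewrite seg_point_0, seg_point_1 in K; exact K.
- exact (is_RInt_swap (V := C_R_NormedModule) _ _ _ _ (is_CInt_seg f p q H)).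
Qed.

Definition midpoint (p q : C) : C := seg_point p q (1 / 2).

Lemma seg_int_midpoint (f : C -> C) (p q : C) : seg_cont f p q ->
  seg_int f p q = (seg_int f p (midpoint p q) + seg_int f (midpoint p q) q)%C.
Proof.
intros H.
apply (is_CInt_unique (fun t => (q - p) * f (seg_point p q t))%C 0 1); [apply is_CInt_seg, H|].
apply (is_RInt_Chasles (V := C_R_NormedModule) _ 0 (1 / 2) 1).
- assert (K := is_CInt_subsegment f p q 0 (1 / 2) H ltac:(lra) ltac:(lra)).
  rewrite seg_point_0 in K; exact K.
- assert (K := is_CInt_subsegment f p q (1 / 2) 1 H ltac:(lra) ltac:(lra)).
  rewrite seg_point_1 in K; exact K.
Qed.

(** * Goursat's lemma and primitives *)

Definition holomorphic_on (f : C -> C) (a : C) (r : R) : Prop :=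
  forall z, Cmod (z - a) < r -> ex_Cderive f z.

Lemma holomorphic_on_seg_cont (f : C -> C) (a p q : C) (r : R) :
  holomorphic_on f a r -> Cmod (p - a) < r -> Cmod (q - a) < r -> seg_cont f p q.
Proof.
intros H Hp Hq t Ht; apply Pcont_comp; [|apply Pcont_seg_point].
apply H, seg_point_disk; assumption.
Qed.

Lemma Cmod_midpoint (p q : C) : Cmod (midpoint p q - p) = / 2 * Cmod (q - p).
Proof.
unfold midpoint, seg_point.
replace (p + RtoC (1 / 2) * (q - p) - p)%C with (RtoC (1 / 2) * (q - p))%C by ring.
rewrite Cmod_mult, Cmod_R, Rabs_right; lra.
Qed.

Definition triangle : Type := (C * C * C)%type.

Definition corner (T : triangle) : C := fst (fst T).

Definition tri_boundary_int (f : C -> C) (T : triangle) : C :=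
  let '(p, q, s) := T in tri_int f p q s.

Definition perimeter (T : triangle) : R :=
  let '(p, q, s) := T in Cmod (q - p) + Cmod (s - q) + Cmod (p - s).

Definition tri_in_ball (a : C) (rho : R) (T : triangle) : Prop :=
  let '(p, q, s) := T in
  Cmod (p - a) <= rho /\ Cmod (q - a) <= rho /\ Cmod (s - a) <= rho.

Lemma midpoint_half (p q : C) : midpoint p q = (/ 2 * (p + q))%C.
Proof.
unfold midpoint, seg_point.
replace (RtoC (1 / 2)) with (/ 2)%C by (rewrite RtoC_div; [field|lra]).
field.
Qed.

Lemma Cmod_half (w : C) : Cmod (/ 2 * w) = / 2 * Cmod w.
Proof.
rewrite Cmod_mult, Cmod_inv by (intros H; apply RtoC_inj in H; lra).
rewrite Cmod_R, Rabs_right; lra.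
Qed.

(** The sides of the medial triangle [x y z] are traversed twice, in opposite
    directions. *)
Lemma tri_int_subdivide (f : C -> C) (a : C) (r : R) (p q s : C) :
  holomorphic_on f a r -> Cmod (p - a) < r -> Cmod (q - a) < r -> Cmod (s - a) < r ->
  let x := midpoint p q in let y := midpoint q s in let z := midpoint s p in
  tri_int f p q s =
    (tri_int f p x z + tri_int f x q y + (tri_int f z y s + tri_int f x y z))%C.
Proof.
intros Hf Hp Hq Hs x y z.
assert (M : forall u v, Cmod (u - a) < r -> Cmod (v - a) < r -> Cmod (midpoint u v - a) < r)
  by (intros; apply seg_point_disk; [lra|assumption|assumption]).
assert (Hx : Cmod (x - a) < r) by (apply M; assumption).
assert (Hy : Cmod (y - a) < r) by (apply M; assumption).
assert (Hz : Cmod (z - a) < r) by (apply M; assumption).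
assert (Hc : forall u v, Cmod (u - a) < r -> Cmod (v - a) < r -> seg_cont f u v)
  by (intros; eapply holomorphic_on_seg_cont; eassumption).
unfold tri_int.
rewrite (seg_int_midpoint f p q), (seg_int_midpoint f q s), (seg_int_midpoint f s p) by auto.
fold x y z.
rewrite (seg_int_swap f x z), (seg_int_swap f y x), (seg_int_swap f z y) by auto.
rewrite (seg_int_swap f z x), (seg_int_swap f x y), (seg_int_swap f y z) by auto.
ring.
Qed.

(** One of the four triangles cut out by the midpoints carries at least a quarter
    of the integral.  A [sig] type lets the bisection be iterated as a
    function. *)
Lemma tri_bisect (f : C -> C) (a : C) (r rho : R) (T : triangle) :
  holomorphic_on f a r -> rho < r ->
  { T' : triangle | tri_in_ball a rho T ->
      tri_in_ball a rho T' /\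
      perimeter T' = / 2 * perimeter T /\
      Cmod (corner T' - corner T) <= / 2 * perimeter T /\
      Cmod (tri_boundary_int f T) <= 4 * Cmod (tri_boundary_int f T') }.
Proof.
intros Hf Hr; destruct T as [[p q] s].
set (x := midpoint p q); set (y := midpoint q s); set (z := midpoint s p).
assert (P1 := Cmod_ge_0 (q - p)). assert (P2 := Cmod_ge_0 (s - q)). assert (P3 := Cmod_ge_0 (p - s)).
assert (B : forall u v, Cmod (u - a) <= rho -> Cmod (v - a) <= rho -> Cmod (midpoint u v - a) <= rho)
  by (intros; apply seg_point_ball; [lra|assumption|assumption]).
assert (Hxp : Cmod (x - p) <= / 2 * (Cmod (q - p) + Cmod (s - q) + Cmod (p - s)))
  by (unfold x; rewrite Cmod_midpoint; lra).
assert (Hzp : Cmod (z - p) <= / 2 * (Cmod (q - p) + Cmod (s - q) + Cmod (p - s))).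
{ unfold z; rewrite midpoint_half.
  replace (/ 2 * (s + p) - p)%C with (/ 2 * (s - p))%C by field.
  rewrite Cmod_half, (Cmod_sub_sym s p); lra. }
(* Each side of the new triangle is half of a side of the old one, up to
   orientation. *)
assert (Per : forall u v w u' v' w',
  (v' - u')%C = (/ 2 * (v - u))%C \/ (v' - u')%C = (/ 2 * (u - v))%C ->
  (w' - v')%C = (/ 2 * (w - v))%C \/ (w' - v')%C = (/ 2 * (v - w))%C ->
  (u' - w')%C = (/ 2 * (u - w))%C \/ (u' - w')%C = (/ 2 * (w - u))%C ->
  Cmod (v' - u') + Cmod (w' - v') + Cmod (u' - w') =
    / 2 * (Cmod (v - u) + Cmod (w - v) + Cmod (u - w))).
{ intros u v w u' v' w' H1 H2 H3.
  assert (E : forall b c b' c', (b' - c')%C = (/ 2 * (b - c))%C \/ (b' - c')%C = (/ 2 * (c - b))%C ->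
    Cmod (b' - c') = / 2 * Cmod (b - c)).
  { intros b c b' c' [Hb|Hb]; rewrite Hb, Cmod_half; [reflexivity|now rewrite Cmod_sub_sym]. }
  rewrite (E _ _ _ _ H1), (E _ _ _ _ H2), (E _ _ _ _ H3); ring. }
destruct (Rle_dec (Cmod (tri_int f p q s)) (4 * Cmod (tri_int f p x z))) as [H1|H1];
[exists (p, x, z)|
destruct (Rle_dec (Cmod (tri_int f p q s)) (4 * Cmod (tri_int f x q y))) as [H2|H2];
[exists (x, q, y)|
destruct (Rle_dec (Cmod (tri_int f p q s)) (4 * Cmod (tri_int f z y s))) as [H3|H3];
[exists (z, y, s)|exists (x, y, z)]]];
intros [Hp [Hq Hs]];
(split; [simpl; unfold x, y, z; auto|]);
(split; [simpl; first
  [ apply Per; unfold x, y, z; rewrite !midpoint_half; solve [left; field|right; field]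
  | rewrite (Per s p q x y z); [ring|..];
    unfold x, y, z; rewrite !midpoint_half; solve [left; field|right; field] ]|]);
(split; [unfold corner; simpl; try assumption|]); simpl; try assumption.
- replace (p - p)%C with (RtoC 0) by ring; rewrite Cmod_0; lra.
- assert (E := tri_int_subdivide f a r p q s Hf ltac:(lra) ltac:(lra) ltac:(lra)).
  simpl in E. fold x y z in E. rewrite E in H1, H2, H3 |- *.
  assert (T1 := Cmod_triangle (tri_int f p x z + tri_int f x q y) (tri_int f z y s + tri_int f x y z)).
  assert (T2 := Cmod_triangle (tri_int f p x z) (tri_int f x q y)).
  assert (T3 := Cmod_triangle (tri_int f z y s) (tri_int f x y z)).
  lra.
Qed.

(** The intervals [[u n - e n, u n + e n]] are nested. *)
Lemma limit_of_summable_steps (u : nat -> R) (e : nat -> R) :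
  (forall n, 0 <= e n) ->
  (forall n, Rabs (u (S n) - u n) <= e n - e (S n)) ->
  exists l, forall n, Rabs (l - u n) <= e n.
Proof.
intros He Hu.
assert (Hinc : forall n k, u n - e n <= u (n + k)%nat - e (n + k)%nat).
{ intros n k; induction k; [rewrite Nat.add_0_r; lra|].
  rewrite Nat.add_succ_r; specialize (Hu (n + k)%nat); apply Rabs_le_between in Hu; lra. }
assert (Hdec : forall n k, u (n + k)%nat + e (n + k)%nat <= u n + e n).
{ intros n k; induction k; [rewrite Nat.add_0_r; lra|].
  rewrite Nat.add_succ_r; specialize (Hu (n + k)%nat); apply Rabs_le_between in Hu; lra. }
assert (Hsep : forall n k, u n - e n <= u k + e k).
{ intros n k; assert (H1 := Hinc n k); assert (H2 := Hdec k n).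
  rewrite Nat.add_comm in H2; specialize (He (n + k)%nat); lra. }
destruct (completeness (fun x => exists n, x = u n - e n)) as [l [Hub Hlub]].
- exists (u 0%nat + e 0%nat); intros x [n ->]; apply Hsep.
- exists (u 0%nat - e 0%nat), 0%nat; reflexivity.
- exists l; intros n; apply Rabs_le_between.
  assert (H1 : u n - e n <= l) by (apply Hub; exists n; reflexivity).
  assert (H2 : l <= u n + e n) by (apply Hlub; intros x [k ->]; apply Hsep).
  lra.
Qed.

Lemma limit_of_summable_steps_C (u : nat -> C) (e : nat -> R) :
  (forall n, 0 <= e n) ->
  (forall n, Cmod (u (S n) - u n) <= e n - e (S n)) ->
  exists l, forall n, Cmod (l - u n) <= 2 * e n.
Proof.
intros He Hu.
assert (Hc : forall z : C, Rabs (fst z) <= Cmod z /\ Rabs (snd z) <= Cmod z).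
{ intros z; assert (H := Rmax_Cmod z); split; eapply Rle_trans; try exact H;
  [apply Rmax_l|apply Rmax_r]. }
destruct (limit_of_summable_steps (fun n => fst (u n)) e He) as [x Hx].
{ intros n; eapply Rle_trans; [|apply Hu]. apply (Hc (u (S n) - u n)%C). }
destruct (limit_of_summable_steps (fun n => snd (u n)) e He) as [y Hy].
{ intros n; eapply Rle_trans; [|apply Hu]. apply (Hc (u (S n) - u n)%C). }
exists (x, y); intros n.
replace ((x, y) - u n)%C with (RtoC (x - fst (u n)) + Ci * RtoC (y - snd (u n)))%C.
2:{ apply injective_projections; simpl; ring. }
eapply Rle_trans; [apply Cmod_triangle|].
rewrite Cmod_mult, Cmod_Ci, !Cmod_R. specialize (Hx n); specialize (Hy n); simpl in Hx, Hy; lra.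
Qed.

Lemma tri_point_close (p q s c : C) (L : R) :
  perimeter (p, q, s) <= L -> Cmod (p - c) <= 2 * L ->
  Cmod (p - c) <= 3 * L /\ Cmod (q - c) <= 3 * L /\ Cmod (s - c) <= 3 * L.
Proof.
intros HL Hp; unfold perimeter in HL.
assert (P1 := Cmod_ge_0 (q - p)). assert (P2 := Cmod_ge_0 (s - q)). assert (P3 := Cmod_ge_0 (p - s)).
assert (T1 := Cmod_sub_triangle q p c). assert (T2 := Cmod_sub_triangle s p c).
rewrite (Cmod_sub_sym s p) in T2. lra.
Qed.

(** A primitive of an affine function, which makes the triangle integrals of
    affine functions vanish. *)
Lemma is_Cderive_poly2 (c0 c1 z0 z : C) :
  is_Cderive (fun w => c0 * w + / 2 * c1 * (w - z0) ^ 2)%C z (c0 + c1 * (z - z0))%C.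
Proof.
apply is_Cderive_quadratic with (d := 1) (K := / 2 * Cmod c1); [lra|].
intros w _.
replace (c0 * w + / 2 * c1 * (w - z0) ^ 2 - (c0 * z + / 2 * c1 * (z - z0) ^ 2)
  - (c0 + c1 * (z - z0)) * (w - z))%C with ((/ 2 * c1) * (w - z) ^ 2)%C by field.
rewrite Cmod_mult, Cmod_half, Cmod_pow; lra.
Qed.

Lemma affine_seg_cont (c0 c1 z0 p q : C) : seg_cont (fun w => c0 + c1 * (w - z0))%C p q.
Proof.
intros t _; apply Pcont_plus; [apply Pcont_const|apply Pcont_mult; [apply Pcont_const|]].
apply Pcont_minus; [apply Pcont_seg_point|apply Pcont_const].
Qed.

Lemma tri_int_affine (c0 c1 z0 p q s : C) :
  tri_int (fun w => c0 + c1 * (w - z0))%C p q s = 0%C.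
Proof.
set (F := (fun w => c0 * w + / 2 * c1 * (w - z0) ^ 2)%C).
assert (E : forall u v, seg_int (fun w => c0 + c1 * (w - z0))%C u v = (F v - F u)%C).
{ intros u v; apply seg_int_FTC; [apply affine_seg_cont|intros; apply is_Cderive_poly2]. }
unfold tri_int; rewrite !E; ring.
Qed.

Lemma tri_int_close (f g : C -> C) (p q s : C) (M : R) :
  (forall u v, List.In u (p :: q :: s :: nil) -> List.In v (p :: q :: s :: nil) ->
    seg_cont f u v /\ seg_cont g u v /\
    forall t, 0 <= t <= 1 -> Cmod (f (seg_point u v t) - g (seg_point u v t)) <= M) ->
  Cmod (tri_int f p q s - tri_int g p q s) <= M * perimeter (p, q, s).
Proof.
intros H.
assert (S : forall u v, List.In u (p :: q :: s :: nil) -> List.In v (p :: q :: s :: nil) ->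
  Cmod (seg_int f u v - seg_int g u v) <= M * Cmod (v - u)).
{ intros u v Hu Hv; destruct (H u v Hu Hv) as [Hf [Hg Hb]]; apply seg_int_close; assumption. }
assert (S1 := S p q ltac:(simpl; auto) ltac:(simpl; auto)).
assert (S2 := S q s ltac:(simpl; auto) ltac:(simpl; auto)).
assert (S3 := S s p ltac:(simpl; auto) ltac:(simpl; auto)).
unfold tri_int, perimeter.
replace (seg_int f p q + seg_int f q s + seg_int f s p
  - (seg_int g p q + seg_int g q s + seg_int g s p))%C with
  ((seg_int f p q - seg_int g p q) + (seg_int f q s - seg_int g q s)
   + (seg_int f s p - seg_int g s p))%C by ring.
eapply Rle_trans; [apply Cmod_triangle|].
assert (T := Cmod_triangle (seg_int f p q - seg_int g p q) (seg_int f q s - seg_int g q s)).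
lra.
Qed.

Lemma pow_half_small (L eps : R) : 0 <= L -> 0 < eps -> exists n, L * (/ 2) ^ n < eps.
Proof.
intros HL He.
destruct (pow_lt_1_zero (/ 2) ltac:(rewrite Rabs_right; lra) (eps / (L + 1))
  ltac:(apply Rdiv_lt_0_compat; lra)) as [n Hn].
exists n; specialize (Hn n (Nat.le_refl n)).
assert (P : 0 < (/ 2) ^ n) by (apply pow_lt; lra).
rewrite Rabs_right in Hn by lra.
assert (H : (L + 1) * (/ 2) ^ n < eps).
{ replace eps with ((L + 1) * (eps / (L + 1))) by (field; lra).
  apply Rmult_lt_compat_l; lra. }
lra.
Qed.

(** Bisection produces triangles [T n] of perimeter [L / 2^n], shrinking to a
    point [z0], with [|I(T 0)| <= 4^n |I(T n)|].  Near [z0], [f] is affine up to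
    [eps |z - z0|], and affine functions integrate to [0], so
    [|I(T n)| <= 3 eps (L / 2^n)^2]: the powers of [4] cancel. *)
Theorem goursat (f : C -> C) (a : C) (r : R) (p q s : C) :
  holomorphic_on f a r ->
  Cmod (p - a) < r -> Cmod (q - a) < r -> Cmod (s - a) < r -> tri_int f p q s = 0%C.
Proof.
intros Hf Hp Hq Hs.
(* The triangles stay in a closed ball, hence so does their limit. *)
set (rho := Rmax (Cmod (p - a)) (Rmax (Cmod (q - a)) (Cmod (s - a)))).
assert (Hr : rho < r) by (repeat apply Rmax_lub_lt; assumption).
set (T0 := (p, q, s) : triangle). set (L := perimeter T0).
assert (HT0 : tri_in_ball a rho T0).
{ unfold T0, rho; simpl; split; [apply Rmax_l|split];
  (eapply Rle_trans; [|apply Rmax_r]); [apply Rmax_l|apply Rmax_r]. }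
assert (HL : 0 <= L).
{ unfold L, T0, perimeter; repeat apply Rplus_le_le_0_compat; apply Cmod_ge_0. }
set (T := nat_rect (fun _ => triangle) T0 (fun _ U => proj1_sig (tri_bisect f a r rho U Hf Hr))).
assert (Hstep : forall n, tri_in_ball a rho (T n) /\ perimeter (T n) = L * (/ 2) ^ n /\
  Cmod (tri_int f p q s) <= 4 ^ n * Cmod (tri_boundary_int f (T n)) /\
  Cmod (corner (T (S n)) - corner (T n)) <= / 2 * perimeter (T n)).
{ assert (N : forall n, tri_in_ball a rho (T n) -> tri_in_ball a rho (T (S n)) /\
      perimeter (T (S n)) = / 2 * perimeter (T n) /\
      Cmod (corner (T (S n)) - corner (T n)) <= / 2 * perimeter (T n) /\
      Cmod (tri_boundary_int f (T n)) <= 4 * Cmod (tri_boundary_int f (T (S n)))).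
  { intros n; simpl; destruct (tri_bisect f a r rho (T n) Hf Hr) as [T' HT']; exact HT'. }
  intros n; induction n as [|n [I1 [I2 [I3 _]]]].
  - destruct (N 0%nat HT0) as [_ [_ [N3 _]]].
    split; [exact HT0|split; [change (L = L * 1); ring|split; [|exact N3]]].
    change (Cmod (tri_int f p q s) <= 1 * Cmod (tri_int f p q s)); lra.
  - destruct (N n I1) as [N1 [N2 [_ N4]]].
    destruct (N (S n) N1) as [_ [_ [M3 _]]].
    split; [exact N1|split; [rewrite N2, I2; simpl; ring|split; [|exact M3]]].
    assert (P : 0 < 4 ^ n) by (apply pow_lt; lra).
    simpl (4 ^ S n); nra. }
destruct (limit_of_summable_steps_C (fun n => corner (T n)) (fun n => L * (/ 2) ^ n)) as [z0 Hz0].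
{ intros n; apply Rmult_le_pos; [exact HL|apply pow_le; lra]. }
{ intros n; destruct (Hstep n) as [_ [E [_ B]]]; rewrite E in B.
  cbv beta; rewrite <- tech_pow_Rmult; lra. }
assert (Hz0r : Cmod (z0 - a) < r).
{ destruct (pow_half_small L ((r - rho) / 2) HL ltac:(lra)) as [n Hn].
  destruct (Hstep n) as [B _]; specialize (Hz0 n); simpl in Hz0.
  assert (K := Cmod_sub_triangle z0 (corner (T n)) a).
  assert (Cmod (corner (T n) - a) <= rho) by (destruct (T n) as [[? ?] ?]; apply B).
  lra. }
destruct (Hf z0 Hz0r) as [l Hl].
assert (Hsmall : forall eps, 0 < eps -> Cmod (tri_int f p q s) <= eps * (3 * L ^ 2)).
{ intros eps Heps.
  destruct (proj1 (is_Cderive_eps _ _ _) Hl eps Heps) as [d [Hd Hfd]].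
  destruct (pow_half_small L (d / 3) HL ltac:(lra)) as [n Hn].
  destruct (Hstep n) as [B [E [G _]]]; specialize (Hz0 n); simpl in Hz0.
  set (e := L * (/ 2) ^ n) in *.
  destruct (T n) as [[p' q'] s'] eqn:ET; unfold corner in Hz0; simpl in Hz0, G.
  rewrite Cmod_sub_sym in Hz0.
  destruct (tri_point_close p' q' s' z0 e) as [Cp [Cq Cs]]; [apply Req_le, E|exact Hz0|].
  destruct B as [Bp [Bq Bs]].
  assert (Hin : forall u, List.In u (p' :: q' :: s' :: nil) -> Cmod (u - a) < r /\ Cmod (u - z0) <= 3 * e).
  { intros u [<-|[<-|[<-|[]]]]; split; lra. }
  assert (K : Cmod (tri_int f p' q' s' - tri_int (fun w => f z0 + l * (w - z0))%C p' q' s')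
    <= eps * (3 * e) * perimeter (p', q', s')).
  { apply tri_int_close; intros u v Hu Hv.
    destruct (Hin u Hu) as [Hu1 Hu2]; destruct (Hin v Hv) as [Hv1 Hv2].
    split; [eapply holomorphic_on_seg_cont; eassumption|split; [apply affine_seg_cont|]].
    intros t Ht.
    assert (D := seg_point_ball z0 u v (3 * e) t Ht Hu2 Hv2).
    replace (f (seg_point u v t) - (f z0 + l * (seg_point u v t - z0)))%C with
      (f (seg_point u v t) - f z0 - l * (seg_point u v t - z0))%C by ring.
    eapply Rle_trans; [apply Hfd; lra|apply Rmult_le_compat_l; lra]. }
  rewrite tri_int_affine, E in K.
  replace (tri_int f p' q' s' - 0)%C with (tri_int f p' q' s') in K by ring.
  assert (P : 0 < 4 ^ n) by (apply pow_lt; lra).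
  eapply Rle_trans; [exact G|].
  replace (eps * (3 * L ^ 2)) with (4 ^ n * (eps * (3 * e) * e)).
  - apply Rmult_le_compat_l; lra.
  - unfold e. replace 4 with (2 * 2) by ring. rewrite Rpow_mult_distr.
    transitivity (eps * 3 * L ^ 2 * ((2 ^ n * (/ 2) ^ n) * (2 ^ n * (/ 2) ^ n))); [ring|].
    rewrite <- Rpow_mult_distr, Rinv_r, pow1 by lra; ring. }
apply Cmod_eq_0.
apply Rle_antisym; [|apply Cmod_ge_0].
apply le_epsilon; intros eps Heps; rewrite Rplus_0_l.
assert (P2 := pow2_ge_0 L).
eapply Rle_trans; [apply (Hsmall (eps / (3 * L ^ 2 + 1))); apply Rdiv_lt_0_compat; lra|].
replace eps with (eps / (3 * L ^ 2 + 1) * (3 * L ^ 2 + 1)) at 2 by (field; lra).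
apply Rmult_le_compat_l; [|lra]. apply Rlt_le, Rdiv_lt_0_compat; lra.
Qed.

(** The integral along [[a, z]]: by Goursat's lemma its increment from [z] to [w]
    is the integral along [[z, w]]. *)
Lemma holomorphic_primitive (f : C -> C) (a : C) (r : R) :
  0 < r -> holomorphic_on f a r ->
  exists F, forall z, Cmod (z - a) < r -> is_Cderive F z (f z).
Proof.
intros Hr Hf; exists (seg_int f a); intros z Hz.
assert (Ha := Cmod_center a r Hr).
apply is_Cderive_eps; intros eps Heps.
destruct (Hf z Hz) as [l Hl].
destruct (is_Cderive_lipschitz _ _ _ Hl) as [d [Hd Hlip]].
assert (Pl := Cmod_ge_0 l).
set (d' := Rmin (r - Cmod (z - a)) (Rmin d (eps / (Cmod l + 1)))).
assert (D1 : d' <= r - Cmod (z - a)) by apply Rmin_l.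
assert (D2 : d' <= d) by (eapply Rle_trans; [apply Rmin_r|apply Rmin_l]).
assert (D3 : d' <= eps / (Cmod l + 1)) by (eapply Rle_trans; [apply Rmin_r|apply Rmin_r]).
exists d'; split.
{ repeat apply Rmin_pos; [lra|exact Hd|apply Rdiv_lt_0_compat; lra]. }
intros w Hw.
assert (Hwa : Cmod (w - a) < r) by (assert (K := Cmod_sub_triangle w z a); lra).
assert (G := goursat f a r a z w Hf Ha Hz Hwa).
unfold tri_int in G.
rewrite (seg_int_swap f a w) in G by (eapply holomorphic_on_seg_cont; eassumption).
replace (seg_int f a w - seg_int f a z - f z * (w - z))%C with
  (seg_int f z w - seg_int (fun _ => f z) z w
   - (seg_int f a z + seg_int f z w + - seg_int f a w))%C
  by (rewrite seg_int_const; ring).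
rewrite G.
replace (seg_int f z w - seg_int (fun _ => f z) z w - 0)%C
  with (seg_int f z w - seg_int (fun _ => f z) z w)%C by ring.
apply seg_int_close; [eapply holomorphic_on_seg_cont; eassumption|apply seg_cont_const|].
intros t Ht.
assert (B := seg_point_dist z w t Ht).
eapply Rle_trans; [apply Hlip; lra|].
replace eps with ((Cmod l + 1) * (eps / (Cmod l + 1))) by (field; lra).
apply Rmult_le_compat_l; lra.
Qed.

(** The mean value inequality, relative to a constant [c]: with [c = 0] it bounds
    an increment of [F], with [c = f p] the remainder at first order. *)
Lemma primitive_increment (F f : C -> C) (a : C) (r M : R) (c p q : C) :
  holomorphic_on f a r ->
  (forall z, Cmod (z - a) < r -> is_Cderive F z (f z)) ->
  Cmod (p - a) < r -> Cmod (q - a) < r ->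
  (forall t, 0 <= t <= 1 -> Cmod (f (seg_point p q t) - c) <= M) ->
  Cmod (F q - F p - c * (q - p)) <= M * Cmod (q - p).
Proof.
intros Hf HF Hp Hq HM.
assert (Hc : seg_cont f p q) by (eapply holomorphic_on_seg_cont; eassumption).
rewrite <- (seg_int_FTC F f p q Hc), <- seg_int_const.
- apply seg_int_close; [exact Hc|apply seg_cont_const|exact HM].
- intros t Ht; apply HF, seg_point_disk; assumption.
Qed.

(** * Rules of complex differentiation *)

(** As a normed module, [C] is not convertible to the ring [C] seen as a module
    over itself, where the rules for products and composites are stated. *)
Lemma is_Cderive_AbsRing (f : C -> C) (z l : C) :
  is_Cderive f z l <->
  is_derive (K := C_AbsRing) (V := AbsRing_NormedModule C_AbsRing) f z l.
Proof. split; intros [_ H]; (split; [apply is_linear_scal_l|exact H]). Qed.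

Lemma is_Cderive_mult (f g : C -> C) (z l m : C) :
  is_Cderive f z l -> is_Cderive g z m ->
  is_Cderive (fun w => f w * g w)%C z (l * g z + f z * m)%C.
Proof.
intros Hf Hg; apply is_Cderive_AbsRing.
apply (is_derive_mult (K := C_AbsRing) f g z l m); [| |exact Cmult_comm];
apply is_Cderive_AbsRing; assumption.
Qed.

Lemma is_Cderive_const (c z : C) : is_Cderive (fun _ => c) z (RtoC 0).
Proof. exact (is_derive_const (K := C_AbsRing) (V := C_NormedModule) c z). Qed.

Lemma is_Cderive_plus (f g : C -> C) (z l m : C) :
  is_Cderive f z l -> is_Cderive g z m -> is_Cderive (fun w => f w + g w)%C z (l + m)%C.
Proof. exact (is_derive_plus (K := C_AbsRing) (V := C_NormedModule) f g z l m). Qed.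

Lemma is_Cderive_minus (f g : C -> C) (z l m : C) :
  is_Cderive f z l -> is_Cderive g z m -> is_Cderive (fun w => f w - g w)%C z (l - m)%C.
Proof. exact (is_derive_minus (K := C_AbsRing) (V := C_NormedModule) f g z l m). Qed.

Lemma is_Cderive_scal (c : C) (f : C -> C) (z l : C) :
  is_Cderive f z l -> is_Cderive (fun w => c * f w)%C z (c * l)%C.
Proof.
intros H; replace (c * l)%C with (0 * f z + c * l)%C by ring.
apply (is_Cderive_mult (fun _ => c) f); [apply is_Cderive_const|exact H].
Qed.

Lemma is_Cderive_shift (c z : C) : is_Cderive (fun w => w - c)%C z (RtoC 1).
Proof.
apply is_Cderive_quadratic with (d := 1) (K := 0); [lra|]; intros w _.
replace (w - c - (z - c) - 1 * (w - z))%C with (RtoC 0) by ring; rewrite Cmod_0; lra.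
Qed.

Lemma locally_disk (a z : C) (r : R) : Cmod (z - a) < r ->
  locally (T := AbsRing_UniformSpace C_AbsRing) z (fun w => Cmod (w - a) < r).
Proof.
intros H; exists (mkposreal (r - Cmod (z - a)) ltac:(lra)); intros w Hw.
assert (K := Cmod_sub_triangle w z a).
change (Cmod (w - z) < r - Cmod (z - a)) in Hw; lra.
Qed.

Lemma is_Cderive_ext_disk (f g : C -> C) (a z l : C) (r : R) : Cmod (z - a) < r ->
  (forall w, Cmod (w - a) < r -> f w = g w) -> is_Cderive f z l -> is_Cderive g z l.
Proof.
intros Hz H; apply is_derive_ext_loc.
destruct (locally_disk a z r Hz) as [d Hd]; exists d; intros w Hw; apply H, Hd, Hw.
Qed.

Lemma is_Cderive_unique (f : C -> C) (z l m : C) :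
  is_Cderive f z l -> is_Cderive f z m -> l = m.
Proof.
intros H1 H2; rewrite <- (is_C_derive_unique f z l H1); apply is_C_derive_unique, H2.
Qed.

(** With [u = 1 / x] and [v = 1 / (x - h)] one has [v - u = h u v]; this is the
    first order expansion of [(x - h)^(-k)] in [h], with a remainder that is
    uniform as long as [x] and [x - h] stay away from [0].  It gives the
    derivatives of negative powers and also those of the integrals of such
    powers that depend on [h]. *)
Lemma inv_pow_expansion (k : nat) (B : R) : 0 <= B ->
  exists K, 0 <= K /\ forall u v h : C, Cmod u <= B -> Cmod v <= B -> (v - u = h * u * v)%C ->
    Cmod (v ^ k - u ^ k - RtoC (INR k) * h * u ^ S k) <= K * Cmod h ^ 2.
Proof.
intros HB; induction k as [|k [K [HK IH]]].
- exists 0; split; [lra|]; intros u v h _ _ _.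
  replace (v ^ 0 - u ^ 0 - RtoC (INR 0) * h * u ^ 1)%C with (RtoC 0) by (simpl; ring).
  rewrite Cmod_0; lra.
- assert (PB : 0 <= B ^ S (S k) * B)
    by (apply Rmult_le_pos; [apply pow_le|]; exact HB).
  assert (Pk := pos_INR k).
  exists (B * K + (1 + INR k) * (B ^ S (S k) * B)).
  split; [apply Rplus_le_le_0_compat; apply Rmult_le_pos; lra|].
  intros u v h Hu Hv E; specialize (IH u v h Hu Hv E).
  replace (v ^ S k - u ^ S k - RtoC (INR (S k)) * h * u ^ S (S k))%C with
    (v * (v ^ k - u ^ k - RtoC (INR k) * h * u ^ S k)
     + RtoC (1 + INR k) * (u ^ S (S k) * v) * h ^ 2)%C.
  2:{ assert (E0 : (v - u - h * u * v)%C = 0%C) by (rewrite E; ring).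
      rewrite S_INR, (Rplus_comm (INR k)), !RtoC_plus, !Cpow_S.
      generalize (u ^ k)%C (v ^ k)%C (RtoC (INR k)); intros U V n.
      rewrite <- (Cplus_0_r (_ + _)), <- (Cmult_0_r (U + (1 + n) * h * (u * U))), <- E0.
      ring. }
  eapply Rle_trans; [apply Cmod_triangle|].
  rewrite !Cmod_mult, !Cmod_pow, Cmod_R, (Rabs_right (1 + INR k)) by lra.
  assert (Ph := pow2_ge_0 (Cmod h)).
  rewrite (Rmult_plus_distr_r (B * K)); apply Rplus_le_compat.
  + rewrite Rmult_assoc; apply Rmult_le_compat; try apply Cmod_ge_0; assumption.
  + apply Rmult_le_compat_r; [exact Ph|]; apply Rmult_le_compat_l; [lra|].
    apply Rmult_le_compat; [apply pow_le, Cmod_ge_0|apply Cmod_ge_0| |exact Hv].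
    apply pow_incr; split; [apply Cmod_ge_0|exact Hu].
Qed.

Lemma is_Cderive_inv_pow (k : nat) (c z : C) : z <> c ->
  is_Cderive (fun w => (/ (w - c)) ^ k)%C z (- RtoC (INR k) * (/ (z - c)) ^ S k)%C.
Proof.
intros Hz.
assert (P : 0 < Cmod (z - c)) by (apply Cmod_gt_0, Cminus_eq_contra, Hz).
destruct (inv_pow_expansion k (2 / Cmod (z - c))) as [K [HK HE]].
{ apply Rlt_le, Rdiv_lt_0_compat; lra. }
apply is_Cderive_quadratic with (d := Cmod (z - c) / 2) (K := K); [lra|].
intros w Hw.
assert (Pw : Cmod (z - c) / 2 <= Cmod (w - c)).
{ assert (H := Cmod_sub_triangle z w c); rewrite (Cmod_sub_sym z w) in H; lra. }
assert (Hwc : (w - c)%C <> 0%C) by (apply Cmod_gt_0; lra).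
assert (Hzc : (z - c)%C <> 0%C) by (apply Cmod_gt_0; lra).
rewrite (Cmod_sub_sym w z).
replace ((/ (w - c)) ^ k - (/ (z - c)) ^ k - - RtoC (INR k) * (/ (z - c)) ^ S k * (w - z))%C
  with ((/ (w - c)) ^ k - (/ (z - c)) ^ k - RtoC (INR k) * (z - w) * (/ (z - c)) ^ S k)%C by ring.
replace (2 / Cmod (z - c)) with (/ (Cmod (z - c) / 2)) in HE by (field; lra).
apply HE; [rewrite Cmod_inv by exact Hzc|rewrite Cmod_inv by exact Hwc|field; auto];
apply Rinv_le_contravar; lra.
Qed.

Lemma zero_derivative_constant (F : C -> C) (a z w : C) (r : R) :
  (forall v, Cmod (v - a) < r -> is_Cderive F v (RtoC 0)) ->
  Cmod (z - a) < r -> Cmod (w - a) < r -> F z = F w.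
Proof.
intros H Hz Hw.
assert (K : Cmod (F w - F z - 0 * (w - z)) <= 0 * Cmod (w - z)).
{ apply (primitive_increment F (fun _ => RtoC 0) a r); try assumption.
  - intros v _; exists (RtoC 0); apply is_Cderive_const.
  - intros t _; replace (0 - 0)%C with (RtoC 0) by ring; rewrite Cmod_0; lra. }
rewrite Rmult_0_l in K.
assert (E : (F w - F z - 0 * (w - z))%C = 0%C)
  by (apply Cmod_eq_0, Rle_antisym; [exact K|apply Cmod_ge_0]).
replace (F z) with (F w - (F w - F z - 0 * (w - z)))%C by ring.
rewrite E; ring.
Qed.

(** * Circles and Cauchy transforms *)

Definition circle (a : C) (rho t : R) : C := (a + RtoC rho * cis t)%C.

Definition circle_velocity (rho t : R) : C := (Ci * RtoC rho * cis t)%C.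

Lemma is_Pderive_circle (a : C) (rho t : R) :
  is_Pderive (circle a rho) t (circle_velocity rho t).
Proof.
unfold circle, circle_velocity.
replace (Ci * RtoC rho * cis t)%C with (RtoC rho * (Ci * cis t))%C by ring.
apply (is_Pderive_comp (fun w => a + RtoC rho * w)%C cis); [|apply is_Pderive_cis].
apply is_Cderive_quadratic with (d := 1) (K := 0); [lra|]; intros w _.
replace (a + RtoC rho * w - (a + RtoC rho * cis t) - RtoC rho * (w - cis t))%C
  with (RtoC 0) by ring.
rewrite Cmod_0; lra.
Qed.

Lemma Pcont_circle (a : C) (rho t : R) : Pcont (circle a rho) t.
Proof. eapply is_Pderive_continuous, is_Pderive_circle. Qed.

Lemma Pcont_circle_velocity (rho t : R) : Pcont (circle_velocity rho) t.
Proof. apply Pcont_mult; [apply Pcont_const|apply Pcont_cis]. Qed.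

Lemma circle_dist (a : C) (rho t : R) : 0 < rho -> Cmod (circle a rho t - a) = rho.
Proof.
intros H; unfold circle.
replace (a + RtoC rho * cis t - a)%C with (RtoC rho * cis t)%C by ring.
rewrite Cmod_mult, Cmod_cis, Cmod_R, Rabs_right; lra.
Qed.

Lemma circle_velocity_mod (rho t : R) : 0 < rho -> Cmod (circle_velocity rho t) = rho.
Proof.
intros H; unfold circle_velocity.
rewrite !Cmod_mult, Cmod_Ci, Cmod_cis, Cmod_R, Rabs_right; lra.
Qed.

Lemma circle_closed (a : C) (rho : R) : circle a rho (2 * PI) = circle a rho 0.
Proof.
unfold circle, cis. rewrite cos_2PI, sin_2PI, cos_0, sin_0; reflexivity.
Qed.

Lemma two_PI_pos : 0 <= 2 * PI.
Proof. assert (H := PI_RGT_0); lra. Qed.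

(** The circle is a closed path. *)
Lemma circle_int_derivative (P p : C -> C) (a : C) (rho : R) :
  (forall t, is_Cderive P (circle a rho t) (p (circle a rho t))) ->
  (forall t, Pcont (fun u => p (circle a rho u)) t) ->
  is_CInt (fun t => p (circle a rho t) * circle_velocity rho t)%C 0 (2 * PI) (RtoC 0).
Proof.
intros HP Hp.
replace (RtoC 0) with (P (circle a rho (2 * PI)) - P (circle a rho 0))%C
  by (rewrite circle_closed; ring).
apply (is_CInt_FTC (fun t => P (circle a rho t))); [apply two_PI_pos| |].
- intros t _; apply is_Pderive_comp; [apply HP|apply is_Pderive_circle].
- intros t _; apply Pcont_mult; [apply Hp|apply Pcont_circle_velocity].
Qed.

Definition cauchy_transform (phi : R -> C) (a : C) (rho : R) (k : nat) (w : C) : C :=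
  CInt (fun t => phi t * (/ (circle a rho t - w)) ^ k)%C 0 (2 * PI).

Lemma circle_off_disk (a w : C) (rho t : R) : 0 < rho ->
  rho - Cmod (w - a) <= Cmod (circle a rho t - w).
Proof.
intros Hr; assert (H := Cmod_sub_triangle (circle a rho t) w a).
rewrite (circle_dist a rho t Hr) in H; lra.
Qed.

Lemma Pcont_cauchy_kernel (a w : C) (rho t : R) (k : nat) :
  Cmod (w - a) < rho -> Pcont (fun u => (/ (circle a rho u - w)) ^ k)%C t.
Proof.
intros Hw; assert (P := Cmod_ge_0 (w - a)).
apply (Pcont_comp (fun z => (/ (z - w)) ^ k)%C (circle a rho)); [|apply Pcont_circle].
eexists; apply is_Cderive_inv_pow; intros E.
assert (H := circle_off_disk a w rho t ltac:(lra)).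
rewrite E in H; replace (w - w)%C with (RtoC 0) in H by ring; rewrite Cmod_0 in H; lra.
Qed.

Lemma is_CInt_cauchy_transform (phi : R -> C) (a w : C) (rho : R) (k : nat) :
  (forall t, Pcont phi t) -> Cmod (w - a) < rho ->
  is_CInt (fun t => phi t * (/ (circle a rho t - w)) ^ k)%C 0 (2 * PI)
    (cauchy_transform phi a rho k w).
Proof.
intros Hphi Hw; apply CInt_correct, ex_CInt_cont; [apply two_PI_pos|]; intros t _.
apply Pcont_mult; [apply Hphi|apply Pcont_cauchy_kernel, Hw].
Qed.

(** Differentiation under the integral sign: [w] and its neighbours stay at a
    distance at least [d] from the circle, so the expansion of the kernel is
    uniform in [t]. *)
Lemma is_Cderive_cauchy_transform (phi : R -> C) (a w : C) (rho M : R) (k : nat) :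
  (forall t, Pcont phi t) -> (forall t, Cmod (phi t) <= M) -> Cmod (w - a) < rho ->
  is_Cderive (cauchy_transform phi a rho k) w
    (RtoC (INR k) * cauchy_transform phi a rho (S k) w)%C.
Proof.
intros Hphi HM Hw. assert (Pwa := Cmod_ge_0 (w - a)).
(* Half of the gap is left to [w], half to its neighbours. *)
set (d := (rho - Cmod (w - a)) / 2). assert (Hd : 0 < d) by (unfold d; lra).
destruct (inv_pow_expansion k (/ d)) as [K [HK HE]];
  [apply Rlt_le, Rinv_0_lt_compat, Hd|].
apply is_Cderive_quadratic with (d := d) (K := (2 * PI - 0) * (M * K)); [exact Hd|].
intros v Hv.
assert (Hva : Cmod (v - a) < rho)
  by (assert (H := Cmod_sub_triangle v w a); unfold d in Hv; lra).
rewrite Rmult_assoc.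
eapply (is_CInt_bound (fun t => phi t * (/ (circle a rho t - v)) ^ k
   - phi t * (/ (circle a rho t - w)) ^ k
   - (RtoC (INR k) * (v - w)) * (phi t * (/ (circle a rho t - w)) ^ S k))%C);
  [apply two_PI_pos| |].
- intros t _.
  assert (Q : forall x, Cmod (x - a) <= rho - d -> (circle a rho t - x)%C <> 0%C /\ Cmod (/ (circle a rho t - x)) <= / d).
  { intros x Hx; assert (H := circle_off_disk a x rho t ltac:(lra)).
    assert (N : (circle a rho t - x)%C <> 0%C) by (apply Cmod_gt_0; lra).
    split; [exact N|rewrite Cmod_inv by exact N; apply Rinv_le_contravar; lra]. }
  destruct (Q w) as [Nw Bw]; [unfold d; lra|].
  destruct (Q v) as [Nv Bv].
  { assert (H := Cmod_sub_triangle v w a); unfold d in Hv |- *; lra. }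
  replace (phi t * (/ (circle a rho t - v)) ^ k - phi t * (/ (circle a rho t - w)) ^ k
    - RtoC (INR k) * (v - w) * (phi t * (/ (circle a rho t - w)) ^ S k))%C with
   (phi t * ((/ (circle a rho t - v)) ^ k - (/ (circle a rho t - w)) ^ k
    - RtoC (INR k) * (v - w) * (/ (circle a rho t - w)) ^ S k))%C by ring.
  rewrite Cmod_mult, Rmult_assoc.
  apply Rmult_le_compat; [apply Cmod_ge_0|apply Cmod_ge_0|apply HM|].
  apply HE; [exact Bw|exact Bv|field; auto].
- replace (RtoC (INR k) * cauchy_transform phi a rho (S k) w * (v - w))%C with
    (RtoC (INR k) * (v - w) * cauchy_transform phi a rho (S k) w)%C by ring.
  apply is_CInt_minus; [apply is_CInt_minus|apply is_CInt_mult];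
  apply is_CInt_cauchy_transform; assumption.
Qed.

(** * Cauchy's formula *)

(** At the centre the integrand is the constant [i].  As a function of [w] the
    integral is constant, since its derivative integrates [1 / (z - w)^2], the
    derivative of [- 1 / (z - w)], over a closed path. *)
Lemma winding_number (a w : C) (rho : R) : 0 < rho -> Cmod (w - a) < rho ->
  cauchy_transform (circle_velocity rho) a rho 1 w = (RtoC (2 * PI) * Ci)%C.
Proof.
intros Hr Hw.
assert (Ha := Cmod_center a rho Hr).
rewrite (zero_derivative_constant _ a w a rho); [|clear w Hw|exact Hw|exact Ha].
- apply CInt_unique.
  eapply is_CInt_ext; [apply two_PI_pos| |].
  + intros t _; instantiate (1 := fun _ => Ci).
    unfold circle, circle_velocity.
    assert (N : cis t <> 0%C) by (apply Cmod_gt_0; rewrite Cmod_cis; lra).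
    assert (Nr : RtoC rho <> 0%C) by (intros E; apply RtoC_inj in E; lra).
    simpl; field. replace (a + rho * cis t - a)%C with (rho * cis t)%C by ring.
    apply Cmult_neq_0; assumption.
  + evar_last; [apply (is_RInt_const (V := C_R_NormedModule))|].
    apply injective_projections; simpl; unfold scal; simpl; unfold mult; simpl; ring.
- intros w Hw.
  assert (E : cauchy_transform (circle_velocity rho) a rho 2 w = 0%C).
  { apply CInt_unique.
    assert (N : forall t, circle a rho t <> w).
    { intros t Et; assert (H := circle_off_disk a w rho t Hr).
      rewrite Et in H; replace (w - w)%C with (RtoC 0) in H by ring; rewrite Cmod_0 in H; lra. }
    replace (RtoC 0) with (- (1) * 0)%C by ring.
    eapply is_CInt_ext; [apply two_PI_pos| |apply is_CInt_mult,
      (circle_int_derivative (fun z => (/ (z - w)) ^ 1)%C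
         (fun z => - RtoC (INR 1) * (/ (z - w)) ^ 2)%C a rho)].
    - intros t _; simpl; ring.
    - intros t; apply is_Cderive_inv_pow, N.
    - intros t; apply Pcont_mult; [apply Pcont_const|apply Pcont_cauchy_kernel, Hw]. }
  replace (RtoC 0) with (RtoC (INR 1) * cauchy_transform (circle_velocity rho) a rho 2 w)%C
    by (rewrite E; ring).
  apply is_Cderive_cauchy_transform with (M := rho); [|intros t|exact Hw].
  + intros t; apply Pcont_circle_velocity.
  + rewrite circle_velocity_mod; lra.
Qed.

(** The circle is mapped by the homothety of centre [w] and ratio [s].  For
    [s <> 0] a primitive in [z] is [Phi (w + s (z - w)) / s]; for [s = 0] the
    integrand is constant. *)
Lemma circle_int_dilate (Phi F : C -> C) (a w s : C) (rho : R) :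
  (forall t, is_Cderive Phi (w + s * (circle a rho t - w))%C (F (w + s * (circle a rho t - w))%C)) ->
  (forall t, Pcont (fun u => F (w + s * (circle a rho u - w))%C) t) ->
  is_CInt (fun t => F (w + s * (circle a rho t - w))%C * circle_velocity rho t)%C 0 (2 * PI) (RtoC 0).
Proof.
intros HPhi HF.
destruct (Ceq_dec s 0%C) as [->|Hs].
- apply (circle_int_derivative (fun z => F w * (z - 0))%C (fun z => F (w + 0 * (z - w))%C)); [|exact HF].
  intros t; replace (F (w + 0 * (circle a rho t - w))%C) with (F w * 1)%C
    by (rewrite Cmult_1_r; f_equal; ring).
  apply is_Cderive_scal, is_Cderive_shift.
- apply (circle_int_derivative (fun z => / s * Phi (w + s * (z - w)))%C (fun z => F (w + s * (z - w))%C)); [|exact HF].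
  intros t.
  replace (F (w + s * (circle a rho t - w))%C) with (/ s * (s * F (w + s * (circle a rho t - w))%C))%C
    by (field; exact Hs).
  apply is_Cderive_scal.
  apply is_Cderive_AbsRing.
  apply (is_derive_comp (K := C_AbsRing) (V := AbsRing_NormedModule C_AbsRing) Phi (fun z => w + s * (z - w))%C).
  + apply is_Cderive_AbsRing, HPhi.
  + apply is_Cderive_AbsRing.
    apply is_Cderive_quadratic with (d := 1) (K := 0); [lra|]; intros v _.
    match goal with |- Cmod ?x <= _ => replace x with (RtoC 0) by ring end.
    rewrite Cmod_0; lra.
Qed.

(** Let [phi s] be the integral of [Phi (w + s (z - w)) / (z - w)] over the
    circle, so that [phi 1] is the Cauchy integral of [Phi] and [phi 0] is
    [Phi w] times the winding number.  Differentiating under the integral, the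
    factor [z - w] cancels and [phi' s] is the integral of [F (w + s (z - w))],
    which is [0].  The quadratic estimate on [Phi] is what justifies the
    differentiation.  Taking [s] complex, in the disk of centre [1/2] and radius
    [1], puts [0] and [1] in the interior of one disk; there [|s|] and [|1 - s|]
    are less than [3/2], which is why [Phi] is needed up to radius [3 rho]. *)
Lemma cauchy_formula (Phi F : C -> C) (a w : C) (rho M : R) :
  0 < rho -> Cmod (w - a) < rho -> 0 <= M ->
  (forall z, Cmod (z - a) < 3 * rho -> is_Cderive Phi z (F z)) ->
  holomorphic_on F a (3 * rho) ->
  (forall z v, Cmod (z - a) < 3 * rho -> Cmod (v - a) < 3 * rho ->
     Cmod (Phi v - Phi z - F z * (v - z)) <= M * Cmod (v - z) ^ 2) ->
  cauchy_transform (fun t => Phi (circle a rho t) * circle_velocity rho t)%C a rho 1 w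
    = (RtoC (2 * PI) * Ci * Phi w)%C.
Proof.
intros Hr Hw HM HPhi HF Hq.
set (zeta := fun (s : C) t => (w + s * (circle a rho t - w))%C).
set (phi := fun s => CInt (fun t => Phi (zeta s t) *
    (circle_velocity rho t * (/ (circle a rho t - w)) ^ 1))%C 0 (2 * PI)).
assert (Hz : forall s t, Cmod (s - RtoC (1 / 2)) < 1 -> Cmod (zeta s t - a) < 3 * rho).
{ intros s t Hs; unfold zeta.
  replace (w + s * (circle a rho t - w) - a)%C
    with ((1 - s) * (w - a) + s * (circle a rho t - a))%C by ring.
  eapply Rle_lt_trans; [apply Cmod_triangle|]; rewrite !Cmod_mult, circle_dist by exact Hr.
  assert (Cmod s < 3 / 2).
  { replace s with (s - RtoC (1 / 2) + RtoC (1 / 2))%C by ring.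
    eapply Rle_lt_trans; [apply Cmod_triangle|]; rewrite Cmod_R, Rabs_right by lra; lra. }
  assert (Cmod (1 - s) < 3 / 2).
  { replace (1 - s)%C with (RtoC (1 / 2) - (s - RtoC (1 / 2)))%C
      by (replace (RtoC 1) with (RtoC (1 / 2) + RtoC (1 / 2))%C
            by (rewrite <- RtoC_plus; f_equal; lra); ring).
    eapply Rle_lt_trans; [apply Cmod_sub_le|]; rewrite Cmod_R, Rabs_right by lra; lra. }
  assert (P1 := Cmod_ge_0 (1 - s)). assert (P2 := Cmod_ge_0 (w - a)). nra. }
assert (Czeta : forall s t, Pcont (zeta s) t).
{ intros s t; unfold zeta; apply Pcont_plus; [apply Pcont_const|].
  apply Pcont_mult; [apply Pcont_const|apply Pcont_minus; [apply Pcont_circle|apply Pcont_const]]. }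
assert (CPhi : forall s t, Cmod (s - RtoC (1 / 2)) < 1 -> Pcont (fun u => Phi (zeta s u)) t).
{ intros s t Hs; apply Pcont_comp; [eexists; apply HPhi, Hz, Hs|apply Czeta]. }
assert (CF : forall s t, Cmod (s - RtoC (1 / 2)) < 1 -> Pcont (fun u => F (zeta s u)) t).
{ intros s t Hs; apply Pcont_comp; [apply HF, Hz, Hs|apply Czeta]. }
assert (Ck : forall t, Pcont (fun u => circle_velocity rho u * (/ (circle a rho u - w)) ^ 1)%C t).
{ intros t; apply Pcont_mult; [apply Pcont_circle_velocity|apply Pcont_cauchy_kernel, Hw]. }
assert (Hphi : forall s, Cmod (s - RtoC (1 / 2)) < 1 ->
  is_CInt (fun t => Phi (zeta s t) * (circle_velocity rho t * (/ (circle a rho t - w)) ^ 1))%C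
    0 (2 * PI) (phi s)).
{ intros s Hs; apply CInt_correct, ex_CInt_cont; [apply two_PI_pos|]; intros t _.
  apply Pcont_mult; [apply CPhi, Hs|apply Ck]. }
assert (Hne : forall t, (circle a rho t - w)%C <> 0%C).
{ intros t; apply Cmod_gt_0; assert (H := circle_off_disk a w rho t Hr); lra. }
assert (D : forall s, Cmod (s - RtoC (1 / 2)) < 1 -> is_Cderive phi s (RtoC 0)).
{ intros s Hs.
  apply is_Cderive_quadratic
    with (d := 1 - Cmod (s - RtoC (1 / 2))) (K := (2 * PI - 0) * (M * (2 * rho * rho))); [lra|].
  intros s' Hs's.
  assert (Hs' : Cmod (s' - RtoC (1 / 2)) < 1)
    by (assert (T := Cmod_sub_triangle s' s (RtoC (1 / 2))); lra).
  assert (Z : is_CInt (fun t => (s' - s) * (F (zeta s t) * circle_velocity rho t))%C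
    0 (2 * PI) ((s' - s) * 0)%C).
  { apply is_CInt_mult, circle_int_dilate with (Phi := Phi).
    - intros t; apply HPhi, (Hz s t), Hs.
    - intros t; apply (CF s t), Hs. }
  replace (phi s' - phi s - 0 * (s' - s))%C with (phi s' - phi s - (s' - s) * 0)%C by ring.
  rewrite Rmult_assoc.
  eapply is_CInt_bound; [apply two_PI_pos| |
    apply is_CInt_minus; [apply is_CInt_minus; apply Hphi; assumption|exact Z]].
  intros t _; simpl.
  set (x := (circle a rho t - w)%C).
  assert (Hx : x <> 0%C) by apply Hne.
  assert (Bx : Cmod x <= 2 * rho).
  { assert (T := Cmod_sub_triangle (circle a rho t) a w); rewrite circle_dist in T by exact Hr.
    rewrite (Cmod_sub_sym a w) in T; unfold x; lra. }
  match goal with |- Cmod ?e <= _ =>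
    replace e with ((Phi (zeta s' t) - Phi (zeta s t) - F (zeta s t) * (zeta s' t - zeta s t))
      * (circle_velocity rho t * / x))%C end.
  2:{ replace (zeta s' t - zeta s t)%C with ((s' - s) * x)%C by (unfold zeta, x; ring).
      field; exact Hx. }
  assert (Q := Hq (zeta s t) (zeta s' t) (Hz s t Hs) (Hz s' t Hs')).
  replace (zeta s' t - zeta s t)%C with ((s' - s) * x)%C in Q |- * by (unfold zeta, x; ring).
  assert (Px : 0 < Cmod x) by (apply Cmod_gt_0, Hx).
  rewrite Cmod_mult, Cmod_mult, circle_velocity_mod, Cmod_inv by assumption.
  rewrite Cmod_mult in Q.
  assert (Pk : 0 < rho * / Cmod x) by (apply Rmult_lt_0_compat; [exact Hr|apply Rinv_0_lt_compat, Px]).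
  eapply Rle_trans; [apply Rmult_le_compat_r; [lra|exact Q]|].
  replace (M * (Cmod (s' - s) * Cmod x) ^ 2 * (rho * / Cmod x)) with
    (M * (Cmod (s' - s) ^ 2 * (Cmod x * rho))) by (field; lra).
  assert (P2 := pow2_ge_0 (Cmod (s' - s))).
  replace (M * (2 * rho * rho) * (Cmod (s' - s) * (Cmod (s' - s) * 1))) with
    (M * (Cmod (s' - s) ^ 2 * (2 * rho * rho))) by ring.
  apply Rmult_le_compat_l; [exact HM|apply Rmult_le_compat_l; [exact P2|]].
  apply Rmult_le_compat_r; lra. }
assert (B1 : Cmod (1 - RtoC (1 / 2)) < 1)
  by (rewrite <- RtoC_minus, Cmod_R, Rabs_right; lra).
assert (B0 : Cmod (0 - RtoC (1 / 2)) < 1)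
  by (rewrite <- RtoC_minus, Cmod_R, Rabs_left; lra).
transitivity (phi 1%C); [|transitivity (phi 0%C)].
- apply CInt_unique. eapply is_CInt_ext; [apply two_PI_pos| |apply Hphi, B1].
  intros t _; simpl. unfold zeta.
  replace (w + 1 * (circle a rho t - w))%C with (circle a rho t) by ring; ring.
- apply (zero_derivative_constant phi (RtoC (1 / 2)) 1 0 1 D B1 B0).
- rewrite <- (winding_number a w rho Hr Hw), Cmult_comm.
  apply CInt_unique.
  eapply is_CInt_ext; [apply two_PI_pos| |apply is_CInt_mult, is_CInt_cauchy_transform;
    [apply Pcont_circle_velocity|exact Hw]].
  intros t _; cbv beta; f_equal; f_equal; unfold zeta; ring.
Qed.

(** * Derivatives of holomorphic functions are holomorphic *)

Lemma holomorphic_on_le (f : C -> C) (a : C) (r r' : R) :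
  r' <= r -> holomorphic_on f a r -> holomorphic_on f a r'.
Proof. intros Hr H z Hz; apply H; lra. Qed.

Lemma C_derive_is_Cderive (f : C -> C) (z : C) :
  ex_Cderive f z -> is_Cderive f z (C_derive f z).
Proof. exact (C_derive_correct f z z). Qed.

Lemma holomorphic_locally_bounded (f : C -> C) (a : C) (r : R) : 0 < r -> holomorphic_on f a r ->
  exists r' M, 0 < r' <= r /\ 0 <= M /\ forall z, Cmod (z - a) < r' -> Cmod (f z) <= M.
Proof.
intros Hr Hf; destruct (Hf a (Cmod_center a r Hr)) as [l Hl].
destruct (is_Cderive_lipschitz _ _ _ Hl) as [d [Hd Hlip]].
assert (Pl := Cmod_ge_0 l). assert (Pf := Cmod_ge_0 (f a)).
exists (Rmin r d), (Cmod (f a) + (Cmod l + 1) * r).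
split; [split; [apply Rmin_pos; assumption|apply Rmin_l]|split; [nra|]].
intros z Hz.
assert (H1 : Cmod (z - a) < r) by (eapply Rlt_le_trans; [exact Hz|apply Rmin_l]).
assert (H2 : Cmod (z - a) < d) by (eapply Rlt_le_trans; [exact Hz|apply Rmin_r]).
assert (T := Cmod_triangle_rev (f z) (f a)). specialize (Hlip z H2).
assert (T2 : (Cmod l + 1) * Cmod (z - a) <= (Cmod l + 1) * r) by (apply Rmult_le_compat_l; lra).
lra.
Qed.

Lemma derivative_bound_lipschitz (F f : C -> C) (a p q : C) (r M : R) :
  holomorphic_on f a r -> (forall z, Cmod (z - a) < r -> is_Cderive F z (f z)) ->
  (forall z, Cmod (z - a) < r -> Cmod (f z) <= M) ->
  Cmod (p - a) < r -> Cmod (q - a) < r -> Cmod (F q - F p) <= M * Cmod (q - p).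
Proof.
intros Hf HF HM Hp Hq.
replace (F q - F p)%C with (F q - F p - 0 * (q - p))%C by ring.
apply (primitive_increment F f a r); try assumption.
intros t Ht; replace (f (seg_point p q t) - 0)%C with (f (seg_point p q t)) by ring.
apply HM, seg_point_disk; assumption.
Qed.

(** Differentiating both sides of an integral representation of [P] represents
    [p], one power of the kernel higher. *)
Lemma cauchy_transform_derivative (phi : R -> C) (a c : C) (rho M : R) (k : nat) (P p : C -> C) :
  (forall t, Pcont phi t) -> (forall t, Cmod (phi t) <= M) ->
  (forall z, Cmod (z - a) < rho -> P z = (c * cauchy_transform phi a rho k z)%C) ->
  (forall z, Cmod (z - a) < rho -> is_Cderive P z (p z)) ->
  forall z, Cmod (z - a) < rho -> 
    p z = (c * RtoC (INR k) * cauchy_transform phi a rho (S k) z)%C.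
Proof.
intros Hphi HM HP Hp z Hz.
apply (is_Cderive_unique P z); [apply Hp, Hz|].
apply (is_Cderive_ext_disk (fun z => c * cauchy_transform phi a rho k z)%C P a z _ rho Hz).
- intros w Hw; symmetry; apply HP, Hw.
- rewrite <- Cmult_assoc; apply is_Cderive_scal.
  apply is_Cderive_cauchy_transform with (M := M); assumption.
Qed.

(** Cauchy's formula is applied to a second primitive [Phi] of [f], because only
    there is a uniform quadratic estimate at hand: [f] is locally bounded, hence
    [F] is Lipschitz.  Three differentiations of the formula represent [f'] as a
    Cauchy transform, and a fourth one is possible. *)
Theorem holomorphic_at_C_derive (f : C -> C) (a : C) :
  holomorphic_at f a -> holomorphic_at (C_derive f) a.
Proof.
intros [r0 [Hr0 Hf0]].
destruct (holomorphic_locally_bounded f a r0 Hr0 Hf0) as [r [M [[Hr Hrr0] [HM Hb]]]].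
assert (Hf : holomorphic_on f a r) by (apply holomorphic_on_le with r0; assumption).
destruct (holomorphic_primitive f a r Hr Hf) as [F HF].
assert (HolF : holomorphic_on F a r) by (intros z Hz; exists (f z); apply HF, Hz).
destruct (holomorphic_primitive F a r Hr HolF) as [Phi HPhi].
assert (HolPhi : holomorphic_on Phi a r) by (intros z Hz; exists (F z); apply HPhi, Hz).
set (rho := r / 3).
assert (Hrho : 0 < rho) by (unfold rho; lra).
assert (E3 : 3 * rho = r) by (unfold rho; field).
assert (LF : forall p q, Cmod (p - a) < r -> Cmod (q - a) < r -> Cmod (F q - F p) <= M * Cmod (q - p)).
{ intros p q Hp Hq; apply (derivative_bound_lipschitz F f a p q r M); assumption. }
set (phi := fun t => (Phi (circle a rho t) * circle_velocity rho t)%C).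
assert (Cphi : forall t, Pcont phi t).
{ intros t; apply Pcont_mult; [|apply Pcont_circle_velocity].
  apply Pcont_comp; [apply HolPhi; rewrite circle_dist; lra|apply Pcont_circle]. }
assert (Bphi : exists K, forall t, Cmod (phi t) <= K).
{ exists ((Cmod (Phi a) + (Cmod (F a) + M * r) * r) * rho); intros t; unfold phi.
  rewrite Cmod_mult, circle_velocity_mod by exact Hrho; apply Rmult_le_compat_r; [lra|].
  assert (T := Cmod_triangle_rev (Phi (circle a rho t)) (Phi a)).
  assert (Ha := Cmod_center a r Hr).
  assert (L : Cmod (Phi (circle a rho t) - Phi a) <= (Cmod (F a) + M * r) * Cmod (circle a rho t - a)).
  { apply (derivative_bound_lipschitz Phi F a a _ r); try assumption; [|rewrite circle_dist; lra].
    intros z Hz; assert (T2 := Cmod_triangle_rev (F z) (F a)).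
    specialize (LF a z Ha Hz). assert (M * Cmod (z - a) <= M * r) by (apply Rmult_le_compat_l; lra).
    lra. }
  rewrite circle_dist in L by exact Hrho.
  assert (P := Cmod_ge_0 (F a)).
  assert ((Cmod (F a) + M * r) * rho <= (Cmod (F a) + M * r) * r)
    by (apply Rmult_le_compat_l; [nra|lra]).
  lra. }
destruct Bphi as [K BK].
set (c := (/ (RtoC (2 * PI) * Ci))%C).
assert (Nc : (RtoC (2 * PI) * Ci)%C <> 0%C).
{ apply Cmult_neq_0; [intros E; apply RtoC_inj in E; assert (Ppi := PI_RGT_0); lra|].
  apply Cmod_gt_0; rewrite Cmod_Ci; lra. }
assert (S1 : forall z, Cmod (z - a) < rho -> Phi z = (c * cauchy_transform phi a rho 1 z)%C).
{ intros z Hz; unfold phi.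
  rewrite (cauchy_formula Phi F a z rho M Hrho Hz HM); try (rewrite E3; assumption).
  - unfold c; rewrite Cmult_assoc, Cinv_l, Cmult_1_l by exact Nc; reflexivity.
  - rewrite E3; intros u v Hu Hv.
    replace (M * Cmod (v - u) ^ 2) with (M * Cmod (v - u) * Cmod (v - u)) by ring.
    apply (primitive_increment Phi F a r); try assumption.
    intros t Ht; eapply Rle_trans; [apply LF; [exact Hu|apply seg_point_disk; assumption]|].
    apply Rmult_le_compat_l; [exact HM|].
    apply seg_point_dist, Ht. }
assert (Hlt : forall z, Cmod (z - a) < rho -> Cmod (z - a) < r) by (intros; lra).
assert (S2 := cauchy_transform_derivative phi a _ rho K 1 Phi F Cphi BK S1
  (fun z Hz => HPhi z (Hlt z Hz))).
assert (S3 := cauchy_transform_derivative phi a _ rho K 2 F f Cphi BK S2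
  (fun z Hz => HF z (Hlt z Hz))).
assert (S4 := cauchy_transform_derivative phi a _ rho K 3 f (C_derive f) Cphi BK S3
  (fun z Hz => C_derive_is_Cderive f z (Hf z (Hlt z Hz)))).
exists rho; split; [exact Hrho|]; intros z Hz; eexists.
eapply is_Cderive_ext_disk; [exact Hz|intros w Hw; symmetry; apply S4, Hw|].
apply is_Cderive_scal, is_Cderive_cauchy_transform with (M := K); assumption.
Qed.

Lemma C_derive_n_C_derive (f : C -> C) (n : nat) :
  C_derive_n (C_derive f) n = C_derive_n f (S n).
Proof. induction n; [reflexivity|simpl; rewrite IHn; reflexivity]. Qed.

(** * Taylor expansion *)

Definition taylor_coef (f : C -> C) (a : C) (k : nat) : C :=
  (C_derive_n f k a / RtoC (INR (fact k)))%C.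

Definition taylor_poly (f : C -> C) (a : C) (n : nat) (z : C) : C :=
  sum_n (G := C_AbelianMonoid) (fun k => taylor_coef f a k * (z - a) ^ k)%C n.

Lemma is_Cderive_shift_pow (a z : C) (k : nat) :
  is_Cderive (fun w => (w - a) ^ S k)%C z (RtoC (INR (S k)) * (z - a) ^ k)%C.
Proof.
induction k as [|k IH].
- replace (RtoC (INR 1) * (z - a) ^ 0)%C with (RtoC 1) by (simpl; ring).
  apply (is_derive_ext (V := C_NormedModule) (fun w => w - a)%C); [|apply is_Cderive_shift].
  intros w; simpl; ring.
- replace (RtoC (INR (S (S k))) * (z - a) ^ S k)%C
    with (1 * (z - a) ^ S k + (z - a) * (RtoC (INR (S k)) * (z - a) ^ k))%C
    by (rewrite (S_INR (S k)), RtoC_plus, Cpow_S; ring).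
  exact (is_Cderive_mult (fun w => w - a)%C (fun w => (w - a) ^ S k)%C z _ _
    (is_Cderive_shift a z) IH).
Qed.

Lemma taylor_coef_C_derive (f : C -> C) (a : C) (k : nat) :
  taylor_coef (C_derive f) a k = (RtoC (INR (S k)) * taylor_coef f a (S k))%C.
Proof.
unfold taylor_coef; rewrite C_derive_n_C_derive.
rewrite fact_simpl, mult_INR, RtoC_mult; field.
split; intros E; apply RtoC_inj in E; revert E; [apply INR_fact_neq_0|apply not_0_INR; discriminate].
Qed.

Lemma taylor_poly_S (f : C -> C) (a : C) (n : nat) (z : C) :
  taylor_poly f a (S n) z = (taylor_poly f a n z + taylor_coef f a (S n) * (z - a) ^ S n)%C.
Proof. exact (sum_Sn (G := C_AbelianMonoid) _ n). Qed.

Lemma taylor_poly_0 (f : C -> C) (a : C) (z : C) : taylor_poly f a 0 z = f a.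
Proof.
unfold taylor_poly, taylor_coef; rewrite sum_O; simpl; field.
Qed.

Lemma taylor_poly_center (f : C -> C) (a : C) (n : nat) : taylor_poly f a n a = f a.
Proof.
induction n; [apply taylor_poly_0|].
rewrite taylor_poly_S, IHn, Cpow_S; ring.
Qed.

Lemma is_Cderive_taylor_poly (f : C -> C) (a z : C) (n : nat) :
  is_Cderive (taylor_poly f a (S n)) z (taylor_poly (C_derive f) a n z).
Proof.
assert (St : forall m, is_Cderive (fun w => taylor_coef f a (S m) * (w - a) ^ S m)%C z
   (taylor_coef (C_derive f) a m * (z - a) ^ m)%C).
{ intros m; rewrite taylor_coef_C_derive.
  replace (RtoC (INR (S m)) * taylor_coef f a (S m) * (z - a) ^ m)%C
    with (taylor_coef f a (S m) * (RtoC (INR (S m)) * (z - a) ^ m))%C by ring.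
  apply is_Cderive_scal, is_Cderive_shift_pow. }
induction n as [|n IH].
- replace (taylor_poly (C_derive f) a 0 z) with (0 + taylor_coef (C_derive f) a 0 * (z - a) ^ 0)%C.
  2:{ unfold taylor_poly; rewrite sum_O; ring. }
  apply (is_derive_ext (V := C_NormedModule)
    (fun w => f a + taylor_coef f a 1 * (w - a) ^ 1)%C).
  + intros w; rewrite taylor_poly_S, taylor_poly_0; reflexivity.
  + apply is_Cderive_plus; [apply is_Cderive_const|apply St].
- rewrite taylor_poly_S.
  apply (is_derive_ext (V := C_NormedModule)
    (fun w => taylor_poly f a (S n) w + taylor_coef f a (S (S n)) * (w - a) ^ S (S n))%C).
  + intros w; rewrite (taylor_poly_S f a (S n)); reflexivity.
  + apply is_Cderive_plus; [exact IH|apply St].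
Qed.

Lemma ex_Cderive_taylor_poly (f : C -> C) (a z : C) (n : nat) :
  ex_Cderive (taylor_poly f a n) z.
Proof.
destruct n as [|n]; [|eexists; apply is_Cderive_taylor_poly].
exists (RtoC 0); apply (is_derive_ext (V := C_NormedModule) (fun _ => f a));
  [intros v; symmetry; apply taylor_poly_0|apply is_Cderive_const].
Qed.

(** The remainder of order [n + 1] of [f] vanishes at [a] and its derivative is the
    remainder of order [n] of [f'], so the estimate for [f'] integrates along
    [[a, z]] to the estimate for [f]. *)
Theorem taylor_remainder (n : nat) : forall (f : C -> C) (a : C), holomorphic_at f a ->
  exists r K, 0 < r /\ 0 <= K /\ forall z, Cmod (z - a) < r ->
    Cmod (f z - taylor_poly f a n z) <= K * Cmod (z - a) ^ S n.
Proof.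
induction n as [|n IH]; intros f a Hf.
- destruct Hf as [r [Hr Hf]].
  destruct (Hf a (Cmod_center a r Hr)) as [l Hl].
  destruct (is_Cderive_lipschitz _ _ _ Hl) as [d [Hd Hlip]].
  exists d, (Cmod l + 1); split; [exact Hd|split; [assert (P := Cmod_ge_0 l); lra|]].
  intros z Hz; rewrite taylor_poly_0, pow_1; apply Hlip, Hz.
- assert (Hf' := holomorphic_at_C_derive f a Hf).
  destruct (IH _ a Hf') as [r1 [K [Hr1 [HK HB]]]].
  destruct Hf as [r2 [Hr2 Hf]]. destruct Hf' as [r3 [Hr3 Hf']].
  set (r := Rmin r1 (Rmin r2 r3)).
  assert (L1 : r <= r1) by apply Rmin_l.
  assert (L2 : r <= r2) by (eapply Rle_trans; [apply Rmin_r|apply Rmin_l]).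
  assert (L3 : r <= r3) by (eapply Rle_trans; [apply Rmin_r|apply Rmin_r]).
  assert (Hr : 0 < r) by (repeat apply Rmin_pos; assumption).
  exists r, K; split; [exact Hr|split; [exact HK|]]; intros z Hz.
  set (Rm := fun w => (f w - taylor_poly f a (S n) w)%C).
  set (Rm' := fun w => (C_derive f w - taylor_poly (C_derive f) a n w)%C).
  assert (D : forall w, Cmod (w - a) < r -> is_Cderive Rm w (Rm' w)).
  { intros w Hw; apply is_Cderive_minus; [|apply is_Cderive_taylor_poly].
    apply C_derive_is_Cderive, Hf; lra. }
  assert (H' : holomorphic_on Rm' a r).
  { intros w Hw; destruct (Hf' w ltac:(lra)) as [l Hl].
    destruct (ex_Cderive_taylor_poly (C_derive f) a w n) as [l' Hl'].
    exists (l - l')%C; apply is_Cderive_minus; assumption. }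
  replace (f z - taylor_poly f a (S n) z)%C with (Rm z - Rm a - 0 * (z - a))%C
    by (unfold Rm; rewrite taylor_poly_center; ring).
  replace (K * Cmod (z - a) ^ S (S n)) with (K * Cmod (z - a) ^ S n * Cmod (z - a)) by (simpl; ring).
  apply (primitive_increment Rm Rm' a r); try assumption; [apply Cmod_center, Hr|].
  intros t Ht.
  assert (B := seg_point_dist a z t Ht).
  replace (Rm' (seg_point a z t) - 0)%C with (Rm' (seg_point a z t)) by ring.
  eapply Rle_trans; [apply HB; lra|].
  apply Rmult_le_compat_l; [exact HK|apply pow_incr; split; [apply Cmod_ge_0|exact B]].
Qed.

(** * Circle averages and principal parts *)

(** Convergence at a linear rate of the averages of [f] over circles centred at
    [a], with the existence of the integrals.  The rate is available for every
    function that occurs here, and makes sums and multiples immediate; the factor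
    [2 PI] is kept on the limit to avoid divisions. *)
Definition average_tends (f : C -> C) (a l : C) : Prop :=
  exists r K, 0 < r /\ forall rho, 0 < rho < r -> exists I,
    is_CInt (fun t => f (circle a rho t)) 0 (2 * PI) I /\
    Cmod (I - RtoC (2 * PI) * l) <= K * rho.

Lemma circle_neq_center (a : C) (rho t : R) : 0 < rho -> (circle a rho t - a)%C <> 0%C.
Proof. intros Hr; apply Cmod_gt_0; rewrite circle_dist; exact Hr. Qed.

Lemma circle_velocity_center (a : C) (rho t : R) :
  circle_velocity rho t = (Ci * (circle a rho t - a))%C.
Proof. unfold circle, circle_velocity; ring. Qed.

(** On the circle [f z / (z - a) dz] is [i f z dt]. *)
Lemma average_tends_is_pp (f : C -> C) (a l : C) : average_tends f a l -> is_pp f a l.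
Proof.
intros [r [K [Hr H]]].
assert (HI : forall rho I, 0 < rho -> is_CInt (fun t => f (circle a rho t)) 0 (2 * PI) I ->
  is_CInt (circle_integrand (fun z => f z / (z - a))%C a rho) 0 (2 * PI) (Ci * I)%C).
{ intros rho I Hrho HI.
  eapply is_CInt_ext; [apply two_PI_pos| |apply is_CInt_mult, HI].
  intros t _; simpl.
  change (Ci * f (circle a rho t) =
    f (circle a rho t) / (circle a rho t - a) * circle_velocity rho t)%C.
  rewrite (circle_velocity_center a); field; apply circle_neq_center, Hrho. }
assert (P := PI_RGT_0).
assert (N2 : RtoC (2 * PI) <> 0%C) by (intros E; apply RtoC_inj in E; lra).
assert (NI : Ci <> 0%C) by (apply Cmod_gt_0; rewrite Cmod_Ci; lra).
assert (Hball : forall d rho, 0 < rho -> ball (M := R_UniformSpace) 0 d rho -> rho < d).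
{ intros d rho Hrho Hb; change (Rabs (rho - 0) < d) in Hb.
  rewrite Rminus_0_r, Rabs_right in Hb; lra. }
split.
- exists (mkposreal r Hr); intros rho Hb Hrho.
  destruct (H rho) as [I [HI1 _]]; [split; [exact Hrho|apply (Hball r); assumption]|].
  exists (Ci * I)%C; apply HI; assumption.
- intros Q [eps HQ].
  assert (PK : 0 < Rabs K + 1) by (assert (PK := Rabs_pos K); lra).
  assert (Hd : 0 < Rmin r (eps * (2 * PI) / (Rabs K + 1))).
  { apply Rmin_pos; [exact Hr|apply Rdiv_lt_0_compat; [apply Rmult_lt_0_compat; [apply cond_pos|lra]|exact PK]]. }
  exists (mkposreal _ Hd); intros rho Hb Hrho.
  assert (Hrd := Hball _ rho Hrho Hb); simpl in Hrd.
  assert (B1 := Rmin_l r (eps * (2 * PI) / (Rabs K + 1))).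
  assert (B2 := Rmin_r r (eps * (2 * PI) / (Rabs K + 1))).
  destruct (H rho ltac:(lra)) as [I [HI1 HI2]].
  assert (E : circle_mean f a rho = (I / RtoC (2 * PI))%C).
  { unfold circle_mean, circle_int.
    rewrite (is_RInt_unique (V := C_R_CompleteNormedModule) _ _ _ _ (HI rho I Hrho HI1)).
    field; split; assumption. }
  apply HQ; rewrite E; apply C_NormedModule_mixin_compat1.
  change (Cmod (I / RtoC (2 * PI) - l) < eps).
  replace (I / RtoC (2 * PI) - l)%C with ((I - RtoC (2 * PI) * l) / RtoC (2 * PI))%C
    by (field; exact N2).
  rewrite Cmod_div, Cmod_R, Rabs_right by (exact N2 || lra).
  apply Rmult_lt_reg_r with (2 * PI); [lra|].
  unfold Rdiv; rewrite Rmult_assoc, Rinv_l, Rmult_1_r by lra.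
  eapply Rle_lt_trans; [exact HI2|].
  assert (L := Rle_abs K).
  apply Rle_lt_trans with ((Rabs K + 1) * rho); [nra|].
  replace (eps * (2 * PI)) with ((Rabs K + 1) * (eps * (2 * PI) / (Rabs K + 1))) by (field; lra).
  apply Rmult_lt_compat_l; lra.
Qed.

Lemma average_tends_plus (f g : C -> C) (a l m : C) :
  average_tends f a l -> average_tends g a m -> average_tends (fun z => f z + g z)%C a (l + m)%C.
Proof.
intros [r1 [K1 [Hr1 H1]]] [r2 [K2 [Hr2 H2]]].
exists (Rmin r1 r2), (K1 + K2); split; [apply Rmin_pos; assumption|]; intros rho Hrho.
assert (B1 := Rmin_l r1 r2). assert (B2 := Rmin_r r1 r2).
destruct (H1 rho ltac:(lra)) as [I1 [HI1 E1]]; destruct (H2 rho ltac:(lra)) as [I2 [HI2 E2]].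
exists (I1 + I2)%C; split; [apply is_CInt_plus; assumption|].
replace (I1 + I2 - RtoC (2 * PI) * (l + m))%C with
  ((I1 - RtoC (2 * PI) * l) + (I2 - RtoC (2 * PI) * m))%C by ring.
eapply Rle_trans; [apply Cmod_triangle|lra].
Qed.

Lemma average_tends_scal (c : C) (f : C -> C) (a l : C) :
  average_tends f a l -> average_tends (fun z => c * f z)%C a (c * l)%C.
Proof.
intros [r [K [Hr H]]]; exists r, (Cmod c * K); split; [exact Hr|]; intros rho Hrho.
destruct (H rho Hrho) as [I [HI E]]; exists (c * I)%C; split; [apply is_CInt_mult, HI|].
replace (c * I - RtoC (2 * PI) * (c * l))%C with (c * (I - RtoC (2 * PI) * l))%C by ring.
rewrite Cmod_mult, Rmult_assoc; apply Rmult_le_compat_l; [apply Cmod_ge_0|exact E].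
Qed.

Lemma average_tends_ext (f g : C -> C) (a l : C) (r : R) : 0 < r ->
  (forall z, z <> a -> Cmod (z - a) < r -> f z = g z) ->
  average_tends f a l -> average_tends g a l.
Proof.
intros Hr Hfg [r1 [K [Hr1 H]]].
exists (Rmin r r1), K; split; [apply Rmin_pos; assumption|]; intros rho Hrho.
assert (B1 := Rmin_l r r1). assert (B2 := Rmin_r r r1).
destruct (H rho ltac:(lra)) as [I [HI E]]; exists I; split; [|exact E].
eapply is_CInt_ext; [apply two_PI_pos| |exact HI].
intros t _; apply Hfg.
- intros Ec; apply (circle_neq_center a rho t (proj1 Hrho)); rewrite Ec; ring.
- rewrite circle_dist; lra.
Qed.

Lemma average_tends_small (u : C -> C) (a : C) (r K : R) : 0 < r ->
  (forall z, z <> a -> Cmod (z - a) < r -> ex_Cderive u z) ->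
  (forall z, z <> a -> Cmod (z - a) < r -> Cmod (u z) <= K * Cmod (z - a)) ->
  average_tends u a 0%C.
Proof.
intros Hr Hu HK; exists r, ((2 * PI - 0) * K); split; [exact Hr|]; intros rho Hrho.
assert (Hc : forall t, circle a rho t <> a /\ Cmod (circle a rho t - a) < r).
{ intros t; split; [|rewrite circle_dist; lra].
  intros Ec; apply (circle_neq_center a rho t (proj1 Hrho)); rewrite Ec; ring. }
assert (HI : is_CInt (fun t => u (circle a rho t)) 0 (2 * PI)
   (CInt (fun t => u (circle a rho t)) 0 (2 * PI))).
{ apply CInt_correct, ex_CInt_cont; [apply two_PI_pos|]; intros t _.
  apply Pcont_comp; [apply Hu; apply Hc|apply Pcont_circle]. }
eexists; split; [exact HI|].
match goal with |- Cmod ?x <= _ =>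
  replace x with (CInt (fun t => u (circle a rho t)) 0 (2 * PI)) by ring end.
rewrite Rmult_assoc; eapply is_CInt_bound; [apply two_PI_pos| |exact HI].
intros t _; simpl; eapply Rle_trans; [apply HK; apply Hc|].
rewrite circle_dist; lra.
Qed.

Lemma average_tends_const (a : C) : average_tends (fun _ => 1%C) a 1%C.
Proof.
exists 1, 0; split; [lra|]; intros rho _; exists (RtoC (2 * PI)); split.
- evar_last; [apply (is_RInt_const (V := C_R_NormedModule))|].
  apply injective_projections; simpl; unfold scal; simpl; unfold mult; simpl; ring.
- match goal with |- Cmod ?x <= _ => replace x with (RtoC 0) by ring end.
  rewrite Cmod_0; lra.
Qed.

(** On the circle [(z - a)^(-j-1) dt] is, up to a constant, the differential of
    [(z - a)^(-j-1)]. *)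
Lemma average_tends_inv_pow (a : C) (j : nat) : average_tends (fun z => (/ (z - a)) ^ S j)%C a 0%C.
Proof.
exists 1, 0; split; [lra|]; intros rho [Hrho _]; exists (RtoC 0); split.
2:{ match goal with |- Cmod ?x <= _ => replace x with (RtoC 0) by ring end.
    rewrite Cmod_0; lra. }
assert (Nj : RtoC (INR (S j)) <> 0%C)
  by (intros E; apply RtoC_inj in E; revert E; apply not_0_INR; discriminate).
assert (NI : Ci <> 0%C) by (apply Cmod_gt_0; rewrite Cmod_Ci; lra).
replace (RtoC 0) with (- / (RtoC (INR (S j)) * Ci) * 0)%C by ring.
eapply is_CInt_ext; [apply two_PI_pos| |apply is_CInt_mult,
  (circle_int_derivative (fun z => (/ (z - a)) ^ S j)%C
    (fun z => - RtoC (INR (S j)) * (/ (z - a)) ^ S (S j))%C a rho)].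
- intros t _; cbv beta.
  rewrite (circle_velocity_center a), (Cpow_S _ (S j)).
  field; repeat split; try assumption; apply circle_neq_center, Hrho.
- intros t; apply is_Cderive_inv_pow; intros Ec.
  apply (circle_neq_center a rho t Hrho); rewrite Ec; ring.
- intros t; apply Pcont_mult; [apply Pcont_const|apply Pcont_cauchy_kernel].
  apply Cmod_center, Hrho.
Qed.

Lemma pow_div_pow (x : C) (k j : nat) : x <> 0%C -> (x ^ k / x ^ (k + j) = (/ x) ^ j)%C.
Proof.
intros Hx; rewrite Cpow_add_r, Cpow_inv by exact Hx.
field; split; apply Cpow_nz, Hx.
Qed.

Lemma sub_neq_0 (z a : C) : z <> a -> (z - a)%C <> 0%C.
Proof. apply Cminus_eq_contra. Qed.

(** Only negative powers of [z - a] occur. *)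
Lemma average_tends_low_taylor (g : C -> C) (a : C) (n j : nat) :
  average_tends (fun z => taylor_poly g a n z / (z - a) ^ (n + S j))%C a 0%C.
Proof.
assert (Term : forall k i, average_tends
  (fun z => taylor_coef g a k * ((z - a) ^ k / (z - a) ^ (k + S i)))%C a 0%C).
{ intros k i; replace (RtoC 0) with (taylor_coef g a k * 0)%C by ring.
  apply average_tends_scal.
  apply (average_tends_ext (fun z => (/ (z - a)) ^ S i)%C _ a _ 1 Rlt_0_1);
    [|apply average_tends_inv_pow].
  intros z Hz _; symmetry; apply pow_div_pow, sub_neq_0, Hz. }
revert j; induction n as [|n IH]; intros j.
- apply (average_tends_ext (fun z => taylor_coef g a 0 * ((z - a) ^ 0 / (z - a) ^ (0 + S j)))%C _ a _ 1 Rlt_0_1);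
    [|apply Term].
  intros z _ _; unfold taylor_poly; rewrite sum_O; unfold Cdiv; ring.
- replace (RtoC 0) with (0 + 0)%C by ring.
  apply (average_tends_ext (fun z => taylor_poly g a n z / (z - a) ^ (n + S (S j))
     + taylor_coef g a (S n) * ((z - a) ^ S n / (z - a) ^ (S n + S j)))%C _ a _ 1 Rlt_0_1);
    [|apply average_tends_plus; [apply IH|apply Term]].
  intros z _ _; rewrite taylor_poly_S.
  replace (n + S (S j))%nat with (S n + S j)%nat by lia.
  unfold Cdiv; ring.
Qed.

Lemma ex_Cderive_div_pow (u : C -> C) (a z : C) (p : nat) :
  z <> a -> ex_Cderive u z -> ex_Cderive (fun w => u w * (/ (w - a)) ^ p)%C z.
Proof.
intros Hz [l Hl]; eexists; apply is_Cderive_mult; [exact Hl|apply is_Cderive_inv_pow, Hz].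
Qed.

Lemma Cmod_div_pow_small (a z x : C) (p : nat) (K : R) : z <> a ->
  Cmod x <= K * Cmod (z - a) ^ S p ->
  Cmod (x * (/ (z - a)) ^ p) <= K * Cmod (z - a).
Proof.
intros Hz Hx.
assert (P : 0 < Cmod (z - a)) by (apply Cmod_gt_0, sub_neq_0, Hz).
rewrite Cmod_mult, Cmod_pow, Cmod_inv, pow_inv by (apply sub_neq_0, Hz).
assert (Pp : 0 < Cmod (z - a) ^ p) by (apply pow_lt, P).
apply Rmult_le_reg_r with (Cmod (z - a) ^ p); [exact Pp|].
rewrite Rmult_assoc, Rinv_l, Rmult_1_r by lra.
simpl in Hx; lra.
Qed.

(** The Taylor polynomial of degree [p] divided by [(z - a)^p] consists of negative
    powers, which average to [0], and of the constant [taylor_coef g a p]; the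
    remainder divided by [(z - a)^p] is [O(z - a)]. *)
Theorem average_tends_taylor_coef (g : C -> C) (a : C) (p : nat) : holomorphic_at g a ->
  average_tends (fun z => g z / (z - a) ^ p)%C a (taylor_coef g a p).
Proof.
intros Hg; destruct (taylor_remainder p g a Hg) as [r1 [K [Hr1 [HK HB]]]].
destruct Hg as [r2 [Hr2 Hg]].
assert (Hr : 0 < Rmin r1 r2) by (apply Rmin_pos; assumption).
assert (L1 := Rmin_l r1 r2). assert (L2 := Rmin_r r1 r2).
assert (Rem : average_tends (fun z => (g z - taylor_poly g a p z) * (/ (z - a)) ^ p)%C a 0%C).
{ apply average_tends_small with (r := Rmin r1 r2) (K := K); [exact Hr| |].
  - intros z Hz Hzr; apply (ex_Cderive_div_pow (fun z => g z - taylor_poly g a p z)%C); [exact Hz|].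
    destruct (Hg z ltac:(lra)) as [l Hl].
    destruct (ex_Cderive_taylor_poly g a z p) as [l' Hl'].
    exists (l - l')%C; apply is_Cderive_minus; assumption.
  - intros z Hz Hzr; apply Cmod_div_pow_small; [exact Hz|apply HB; lra]. }
assert (Main : average_tends (fun z => taylor_poly g a p z / (z - a) ^ p)%C a (taylor_coef g a p)).
{ assert (Top : average_tends (fun z => taylor_coef g a p * 1)%C a (taylor_coef g a p * 1)%C)
    by (apply average_tends_scal, average_tends_const).
  rewrite Cmult_1_r in Top.
  destruct p as [|p].
  - apply (average_tends_ext (fun _ => taylor_coef g a 0) _ a _ 1 Rlt_0_1); [|exact Top].
    intros z _ _; unfold taylor_poly; rewrite sum_O; simpl; field.
  - rewrite <- (Cplus_0_l (taylor_coef g a (S p))).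
    apply (average_tends_ext (fun z => taylor_poly g a p z / (z - a) ^ (p + 1)
      + taylor_coef g a (S p))%C _ a _ 1 Rlt_0_1);
      [|apply average_tends_plus; [apply average_tends_low_taylor|exact Top]].
    intros z Hz _; rewrite taylor_poly_S, Nat.add_1_r.
    field; apply Cpow_nz, sub_neq_0, Hz. }
rewrite <- (Cplus_0_r (taylor_coef g a p)).
apply (average_tends_ext (fun z => taylor_poly g a p z / (z - a) ^ p
   + (g z - taylor_poly g a p z) * (/ (z - a)) ^ p)%C _ a _ 1 Rlt_0_1);
  [|apply average_tends_plus; assumption].
intros z Hz _; rewrite Cpow_inv by (apply sub_neq_0, Hz).
field; apply Cpow_nz, sub_neq_0, Hz.
Qed.

Theorem theorem1 (a : C) (f1 f2 : C -> C) (m : nat)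
    (hf1 : holomorphic_at f1 a) (hf2 : pole_of_order f2 a m) :
  ex_pp (fun z => f1 z * f2 z)%C a /\
  (forall k : nat, (k <= m)%nat -> ex_pp (fun z => (z - a) ^ k * f2 z)%C a) /\
  pp (fun z => f1 z * f2 z)%C a =
    sum_n (G := C_AbelianMonoid)
      (fun k => C_derive_n f1 k a / RtoC (INR (fact k))
                * pp (fun z => (z - a) ^ k * f2 z) a)%C m.
Proof.
destruct hf2 as [_ [g [Hg [_ [r [Hr Hf2]]]]]].
(* [b k] is the principal part of [(z - a)^k f2], that is of [g / (z - a)^(m-k)]. *)
set (b := fun k => taylor_coef g a (m - k)).
assert (Hk : forall k, (k <= m)%nat -> average_tends (fun z => (z - a) ^ k * f2 z)%C a (b k)).
{ intros k Hkm.
  apply (average_tends_ext (fun z => g z / (z - a) ^ (m - k))%C _ a _ r Hr);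
    [|apply average_tends_taylor_coef, Hg].
  intros z Hz Hzr; rewrite (Hf2 z Hz Hzr).
  replace m with (k + (m - k))%nat at 2 by lia.
  rewrite Cpow_add_r; field; split; apply Cpow_nz, sub_neq_0, Hz. }
assert (Hpoly : forall n, (n <= m)%nat -> average_tends (fun z => taylor_poly f1 a n z * f2 z)%C a
  (sum_n (G := C_AbelianMonoid) (fun k => taylor_coef f1 a k * b k)%C n)).
{ induction n as [|n IH]; intros Hn.
  - rewrite sum_O.
    apply (average_tends_ext (fun z => taylor_coef f1 a 0 * ((z - a) ^ 0 * f2 z))%C _ a _ 1 Rlt_0_1);
      [|apply average_tends_scal, Hk, Hn].
    intros z _ _; unfold taylor_poly; rewrite sum_O; ring.
  - rewrite sum_Sn.
    apply (average_tends_ext (fun z => taylor_poly f1 a n z * f2 z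
       + taylor_coef f1 a (S n) * ((z - a) ^ S n * f2 z))%C _ a _ 1 Rlt_0_1);
      [|apply average_tends_plus; [apply IH; lia|apply average_tends_scal, Hk, Hn]].
    intros z _ _; rewrite taylor_poly_S; ring. }
assert (Hrem : average_tends (fun z => (f1 z - taylor_poly f1 a m z) * f2 z)%C a 0%C).
{ destruct (taylor_remainder m f1 a hf1) as [r1 [K [Hr1 [HK HB]]]].
  destruct hf1 as [r2 [Hr2 H1]]. destruct Hg as [r3 [Hr3 Hg]].
  destruct (holomorphic_locally_bounded g a r3 Hr3 Hg) as [r4 [M [[Hr4 Hr43] [HM HBg]]]].
  set (d := Rmin (Rmin r r1) (Rmin r2 r4)).
  assert (Hd : 0 < d) by (repeat apply Rmin_pos; assumption).
  assert (Ld : d <= r /\ d <= r1 /\ d <= r2 /\ d <= r4).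
  { assert (Q := Rmin_l (Rmin r r1) (Rmin r2 r4)). assert (Q' := Rmin_r (Rmin r r1) (Rmin r2 r4)).
    assert (Q1 := Rmin_l r r1). assert (Q2 := Rmin_r r r1).
    assert (Q3 := Rmin_l r2 r4). assert (Q4 := Rmin_r r2 r4).
    unfold d; lra. }
  apply (average_tends_ext (fun z => ((f1 z - taylor_poly f1 a m z) * g z) * (/ (z - a)) ^ m)%C
    _ a _ r Hr).
  { intros z Hz Hzr; rewrite (Hf2 z Hz Hzr), Cpow_inv by (apply sub_neq_0, Hz).
    unfold Cdiv; ring. }
  apply average_tends_small with (r := d) (K := K * M); [exact Hd| |].
  - intros z Hz Hzr.
    apply (ex_Cderive_div_pow (fun z => (f1 z - taylor_poly f1 a m z) * g z)%C); [exact Hz|].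
    destruct (H1 z ltac:(lra)) as [l Hl].
    destruct (ex_Cderive_taylor_poly f1 a z m) as [l' Hl'].
    destruct (Hg z ltac:(lra)) as [l'' Hl''].
    eexists; apply (is_Cderive_mult (fun z => f1 z - taylor_poly f1 a m z)%C g);
      [apply is_Cderive_minus; eassumption|exact Hl''].
  - intros z Hz Hzr; apply Cmod_div_pow_small; [exact Hz|].
    rewrite Cmod_mult.
    replace (K * M * Cmod (z - a) ^ S m) with (K * Cmod (z - a) ^ S m * M) by ring.
    apply Rmult_le_compat; [apply Cmod_ge_0|apply Cmod_ge_0|apply HB; lra|apply HBg; lra]. }
assert (Hprod : average_tends (fun z => f1 z * f2 z)%C a
  (sum_n (G := C_AbelianMonoid) (fun k => taylor_coef f1 a k * b k)%C m)).
{ rewrite <- (Cplus_0_r (sum_n _ m)).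
  apply (average_tends_ext (fun z => taylor_poly f1 a m z * f2 z
    + (f1 z - taylor_poly f1 a m z) * f2 z)%C _ a _ 1 Rlt_0_1);
    [intros z _ _; ring|apply average_tends_plus; [apply Hpoly; lia|exact Hrem]]. }
split; [eexists; apply average_tends_is_pp, Hprod|split].
- intros k Hkm; exists (b k); apply average_tends_is_pp, Hk, Hkm.
- rewrite (is_pp_unique _ _ _ (average_tends_is_pp _ _ _ Hprod)).
  apply sum_n_ext_loc; intros k Hkm.
  rewrite (is_pp_unique _ _ _ (average_tends_is_pp _ _ _ (Hk k Hkm))); reflexivity.
Qed.
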